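(* Let $(x_e,u_e)$ be a controlled equilibrium. The optimal control problem (OCP) is strictly dissipative at $(x_e,u_e)$ with a quadratic storage function if and only if there exist a non-negative self-adjoint operator $P\in L(\mathcal H)$ and $m>0$ such that $$\{\tilde w\in\operatorname{dom}A^*: A^*\tilde w=z+C^*Cx_e,\ B^*\tilde w=v+K^*Ku_e\}\cap\operatorname{ran}P^{1/2}\neq\varnothing$$ and $$\|Cx\|^2-2\operatorname{Re}\langle Ax,Px\rangle\ \ge\ m\|x\|^2\qquad\text{for all }x\in\operatorname{dom}A .$$
   Context: Setting: $\mathcal H,\mathcal U,\mathcal Y,\mathcal Z$ are Hilbert spaces (real or complex, over the same field), $A$ generates a $C_0$-semigroup on $\mathcal H$, and $B\in L(\mathcal U,\mathcal H)$, $C\in L(\mathcal H,\mathcal Y)$, $K\in L(\mathcal U,\mathcal Z)$ are bounded linear operators, $z\in\mathcal H$, $v\in\mathcal U$. It is assumed that there is $c_K>0$ with $\|Ku\|\ge c_K\|Bu\|$ for all $u\in\mathcal U$. The optimal control problem (OCP) is $$\min_{u\in L^2(0,T;\mathcal U)}\int_0^T\ell(x,u)\,dt\quad\text{s.t. }\dot x=Ax+Bu,\ x(0)=x_0,$$ with $\ell(x,u)=\|Cx\|^2+\|Ku\|^2+2\operatorname{Re}\langle z,x\rangle+2\operatorname{Re}\langle v,u\rangle$. A controlled equilibrium is a pair $(x_e,u_e)\in\operatorname{dom}A\times\mathcal U$ with $Ax_e+Bu_e=0$. $\mathcal K$ is the set of continuous strictly increasing functions $\alpha:[0,\infty)\to[0,\infty)$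 with $\alpha(0)=0$. A storage function is a (Fréchet, real-linear derivative) $C^1$-function $V:\mathcal H\to\mathbb R$. A quadratic function is one of the form $V_{P,w}(x)=\langle Px,x\rangle+2\operatorname{Re}\langle w,x\rangle$ with $P=P^*\in L(\mathcal H)$ and $w\in\mathcal H$. The OCP is strictly pre-dissipative at a controlled equilibrium $(x_e,u_e)$ with storage function $V$ if there is a dissipation rate $\alpha\in\mathcal K$ such that for all $x\in\operatorname{dom}A$ and $u\in\mathcal U$: $V'(x)(Ax+Bu)\le\ell(x,u)-\ell(x_e,u_e)-\alpha(\|x-x_e\|)$. It is strictly dissipative at $(x_e,u_e)$ with storage function $V$ if it is strictly pre-dissipative at $(x_e,u_e)$ with storage function $V$ and $V$ is bounded from below. A self-adjoint $P\in L(\mathcal H)$ is non-negative if $\langle Px,x\rangle\ge 0$ for all $x$; $P^{1/2}$ is its non-negative square root. *)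

(* Defs.v *)
From HB Require Import structures.
From mathcomp Require Import all_boot all_order all_algebra.
From mathcomp Require Import complex.
From mathcomp Require Import boolp classical_sets functions set_interval.
From mathcomp Require Import reals topology normedtype.

Set Implicit Arguments.
Unset Strict Implicit.
Unset Printing Implicit Defensive.

Import Order.TTheory GRing.Theory Num.Theory.
Import numFieldNormedType.Exports.

Local Open Scope classical_set_scope.
Local Open Scope ring_scope.

(* The scalar field of a Hilbert space is the real line or its complexification;
   a theorem quantified over [k] covers both cases, all spaces that mention the
   same [k] having the same scalars. *)
Variant scalar_kind := RealScalars | ComplexScalars.

Definition scalars (R : realType) (k : scalar_kind) : numFieldType :=
  match k with
  | RealScalars => R
  | ComplexScalars => R[i]
  end.

Definition scalar_conj (R : realType) (k : scalar_kind) :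
    {rmorphism scalars R k -> scalars R k} :=
  match k with
  | RealScalars => (@idfun R : {rmorphism R -> R})
  | ComplexScalars => (Num.conj : {rmorphism R[i] -> R[i]})
  end.

Definition scalar_re (R : realType) (k : scalar_kind) : scalars R k -> R :=
  match k with
  | RealScalars => id
  | ComplexScalars => @complex.Re R
  end.

Definition scalar_of_real (R : realType) (k : scalar_kind) :
    R -> scalars R k :=
  match k with
  | RealScalars => id
  | ComplexScalars => real_complex R
  end.

(* As in [{dot U for theta}], the inner product is linear in its first
   argument and conjugate-linear in the second. *)
HB.mixin Record isHilbert (R : realType) (k : scalar_kind) H
    of CompleteNormedModule (scalars R k) H := {
  inner : {dot H for scalar_conj R k};
  sqr_norm_inner : forall x : H, `|x| ^+ 2 = inner x x
}.

#[short(type="hilbertType")]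
HB.structure Definition Hilbert (R : realType) (k : scalar_kind) :=
  {H of isHilbert R k H & CompleteNormedModule (scalars R k) H}.

Notation "⟨ x , y ⟩" := (inner x y) (at level 0, x, y at level 99,
  format "⟨ x ,  y ⟩") : ring_scope.

Notation "'Re⟨' x , y ⟩" := (scalar_re ⟨x, y⟩) (at level 0, x, y at level 99,
  format "'Re⟨' x ,  y ⟩") : ring_scope.

(* The library norm [`|x|] takes its values in the scalar field, hence in
   [R[i]] for a complex space; its values are real. *)
Definition hnorm (R : realType) (k : scalar_kind) (H : hilbertType R k)
  (x : H) : R := scalar_re `|x|.

Notation "`‖ x ‖" := (hnorm x) (at level 0, x at level 99,
  format "`‖ x ‖") : ring_scope.

#[short(type="boundedOperator")]
HB.structure Definition BoundedOperator (K : numFieldType)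
    (E F : normedModType K) :=
  {f of isContinuous E F f & @GRing.Linear K E F *:%R f}.

Notation "{ 'bounded' E -> F }" := (boundedOperator E F)
  (at level 0, E at level 98, F at level 99,
   format "{ 'bounded'  E  ->  F }") : type_scope.

Section operators.
Context {R : realType} {k : scalar_kind}.
Implicit Types H G : hilbertType R k.

(* The values of [op_fun] outside [op_dom] are irrelevant. *)
Record partial_operator H G := PartialOperator {
  op_dom : set H;
  op_fun :> H -> G
}.

(* [w] is a value at [y] of the adjoint of [A]; it is the only one as soon as
   [op_dom A] is dense. *)
Definition adjoint_value H G (A : partial_operator H G) (y : G) : set H :=
  [set w | forall x, op_dom A x -> ⟨A x, y⟩ = ⟨x, w⟩].

Definition adjoint H G (A : partial_operator H G) : partial_operator G H :=
  PartialOperator [set y | adjoint_value A y !=set0]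
                  (fun y => xget 0 (adjoint_value A y)).

Definition bounded_adjoint H G (f : H -> G) : G -> H :=
  adjoint (PartialOperator setT f).

Definition self_adjoint H (P : H -> H) := bounded_adjoint P = P.

(* [0 <= c] in [R[i]] says that [c] is real and non-negative. *)
Definition nonnegative H (P : H -> H) := forall x, 0 <= ⟨P x, x⟩.

Definition nonneg_sqrt H (P : H -> H) : H -> H :=
  xget (fun=> 0) [set S : H -> H | exists Q : {bounded H -> H},
    [/\ S = Q, self_adjoint Q, nonnegative Q & Q \o Q = P]].

Record C0_semigroup H (T : R -> {bounded H -> H}) : Prop := {
  C0_semigroup0 : forall x, T 0 x = x;
  C0_semigroupD : forall s t, 0 <= s -> 0 <= t ->
    forall x, T (s + t) x = T s (T t x);
  C0_semigroup_cvg : forall x, T t x @[t --> 0^'+] --> x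
}.

Definition is_generator H (T : R -> {bounded H -> H})
    (A : partial_operator H H) :=
  let quotient x (t : R) := scalar_of_real k t^-1 *: (T t x - x) in
  op_dom A = [set x | cvg (quotient x t @[t --> 0^'+])] /\
  forall x, op_dom A x -> quotient x t @[t --> 0^'+] --> A x.

Definition generates_C0_semigroup H (A : partial_operator H H) :=
  exists T : R -> {bounded H -> H}, C0_semigroup T /\ is_generator T A.

(* Differentiability over the reals, also when [H] is a complex space. *)
Record is_real_derivative H (V : H -> R) (x : H) (d : H -> R) : Prop := {
  real_derivativeD : forall h1 h2, d (h1 + h2) = d h1 + d h2;
  real_derivativeZ : forall (a : R) h, d (scalar_of_real k a *: h) = a * d h;
  real_derivative_continuous : continuous d;
  real_derivative_cvg :
    (V (x + h) - V x - d h) / `‖h‖ @[h --> (0 : H)^'] --> (0 : R)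
}.

(* The last clause is continuity of [dV] for the norm of bounded real-linear
   functionals. *)
Definition is_C1_with_derivative H (V : H -> R) (dV : H -> H -> R) :=
  (forall x, is_real_derivative V x (dV x)) /\
  (forall x (e : R), 0 < e ->
     \forall y \near x, forall h, `|dV y h - dV x h| <= e * `‖h‖).

Definition class_K (alpha : R -> R) :=
  [/\ {within `[0, +oo[, continuous alpha},
      {in `[0, +oo[ &, {homo alpha : r s / r < s}} & alpha 0 = 0].

Definition quadratic H (P : H -> H) (w : H) : H -> R :=
  fun x => Re⟨P x, x⟩ + 2 * Re⟨w, x⟩.

End operators.

Section dissipativity.
Context {R : realType} {k : scalar_kind} {H U Y Z : hilbertType R k}.

Definition running_cost (C : H -> Y) (K : U -> Z) (z : H) (v : U)
    (x : H) (u : U) : R :=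
  `‖C x‖ ^+ 2 + `‖K u‖ ^+ 2 + 2 * Re⟨z, x⟩ + 2 * Re⟨v, u⟩.

Variables (A : partial_operator H H) (B : U -> H).

Definition controlled_equilibrium (xe : H) (ue : U) :=
  op_dom A xe /\ A xe + B ue = 0.

Variable ell : H -> U -> R.

Definition strictly_pre_dissipative (xe : H) (ue : U) (V : H -> R) :=
  exists dV, is_C1_with_derivative V dV /\
  exists alpha : R -> R, class_K alpha /\
  forall x u, op_dom A x ->
    dV x (A x + B u) <= ell x u - ell xe ue - alpha `‖x - xe‖.

Definition strictly_dissipative (xe : H) (ue : U) (V : H -> R) :=
  strictly_pre_dissipative xe ue V /\ has_lbound (range V).

End dissipativity.

(* Main.v *)
Require Import Defs.
From HB Require Import structures.
From mathcomp Require Import all_boot all_order all_algebra.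
From mathcomp Require Import complex.
From mathcomp Require Import boolp classical_sets functions set_interval.
From mathcomp Require Import reals topology normedtype.
From mathcomp Require Import derive realfun measure lebesgue_measure.
From mathcomp Require Import lebesgue_integral ftc ring lra.

Set Implicit Arguments.
Unset Strict Implicit.
Unset Printing Implicit Defensive.

Import Order.TTheory GRing.Theory Num.Theory.
Import numFieldNormedType.Exports.

Local Open Scope classical_set_scope.
Local Open Scope ring_scope.

(** Centre everything at the equilibrium: put x = xe + h, u = ue + mu and
    wt = w + P xe.  For the storage function <P x, x> + 2 Re <w, x> the
    dissipation inequality then reads

      2 Re <P h, A h + B mu> + 2 Re <wt, A h + B mu>
        <= |C h|^2 + |K mu|^2 + 2 Re <z + C* C xe, h> + 2 Re <v + K* K ue, mu>
           - alpha |h|,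

    a quadratic form in (h, mu) plus a real-linear one
    ([running_cost_expand]).

    Necessity ([dissipative_necessary]).  Replacing (h, mu) by t (h, mu) and
    letting t tend to 0 from both sides, the linear parts must agree: this is
    A* wt = z + C* C xe and B* wt = v + K* K ue.  The quadratic part at mu = 0
    and |h| = 1 gives the coercivity estimate with m = alpha 1.  A lower bound
    of the storage function forces P >= 0; with S the square root of P, the
    functional |S x|^2 + 2 Re <w, x> is then bounded below, the images under S
    of a minimizing sequence form a Cauchy sequence by the parallelogram law,
    and the first-order condition at their limit says that w lies in ran S
    ([minimizer_representation]).  Hence so does wt = w + S (S xe).

    Sufficiency ([dissipative_sufficient]).  Take c P with a small c > 0 in
    place of P, and w = wt - c P xe.  The linear parts cancel, coercivity
    leaves c m |h|^2 to spare, and the cross term 2 c Re <P h, B mu> is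
    absorbed by it and by |K mu|^2 >= cK^2 |B mu|^2.  As wt = S q, completing
    the square bounds c |S x|^2 + 2 Re <q - c S xe, S x> from below.

    Three facts of functional analysis support this.  The Riesz representation
    of functionals ([real_riesz]), hence of adjoints, is the case S = id of the
    minimization above.  Non-negative operators have square roots
    ([sqrt_exists]), by iterating Y := (B + Y^2) / 2.  The domain of the
    generator of a semigroup T is dense ([generator_dense]), without which A*
    is not single valued; it contains the integrals of orbits of T.

    All estimates use only the real part of the inner product, which treats
    real and complex spaces alike; full identities are recovered by testing on
    all scalar multiples of a vector ([inner_eq_re]). *)

(** * Scalars *)

Section scalars.
Context {R : realType} {k : scalar_kind}.
Implicit Types (a b : scalars R k) (r s : R).

Local Notation re := (@scalar_re R k).
Local Notation of_real := (@scalar_of_real R k).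

Lemma scalar_reD a b : re (a + b) = re a + re b.
Proof. by case: k a b => // -[? ?] [? ?]. Qed.

Lemma scalar_re_conj a : re (scalar_conj R k a) = re a.
Proof. by case: k a => // -[? ?]. Qed.

Lemma scalar_of_realK r : re (of_real r) = r.
Proof. by case: k. Qed.

Lemma scalar_re_mul r a : re (of_real r * a) = r * re a.
Proof. by case: k a => // -[? ?] /=; rewrite mul0r subr0. Qed.

Lemma scalar_of_realD r s : of_real (r + s) = of_real r + of_real s.
Proof. by case: k => //=; rewrite rmorphD. Qed.

Lemma scalar_of_realN r : of_real (- r) = - of_real r.
Proof. by case: k => //=; rewrite rmorphN. Qed.

Lemma scalar_of_realM r s : of_real (r * s) = of_real r * of_real s.
Proof. by case: k => //=; rewrite rmorphM. Qed.

Lemma scalar_of_real1 : of_real 1 = 1.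
Proof. by case: k. Qed.

Lemma scalar_of_real_ge0 r : (0 <= of_real r) = (0 <= r).
Proof. by case: k => //=; rewrite ler0c. Qed.

Lemma scalar_of_real_gt0 r : (0 < of_real r) = (0 < r).
Proof. by case: k => //=; rewrite ltcR. Qed.

Lemma scalar_ge0_real a : 0 <= a -> of_real (re a) = a.
Proof. by case: k a => // -[x y] /=; rewrite lecE /= => /andP[/eqP-> _]. Qed.

Lemma scalar_real_of_conj a : scalar_conj R k a = a -> of_real (re a) = a.
Proof.
case: k a => // -[x y] /= [] /eqP; rewrite eq_sym -addr_eq0 -mulr2n.
by rewrite mulrn_eq0 /= => /eqP->.
Qed.

(** The imaginary part of [a] is the real part of a multiple of [a]. *)
Lemma scalar_re_ext a b : (forall c, re (c * a) = re (c * b)) -> a = b.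
Proof.
case: k a b => /= [a b /(_ 1)|[a a'] [b b'] h]; first by rewrite !mul1r.
have := h 1; have := h (0 +i* 1)%C; rewrite !mul1r /= !mul0r !sub0r !mul1r.
by move=> /oppr_inj-> ->.
Qed.

End scalars.

Local Notation "a *r x" := (scalar_of_real _ a *: x)
  (at level 40, left associativity) : ring_scope.

(** * The real inner product *)

Section real_inner_product.
Context {R : realType} {k : scalar_kind}.
Implicit Types (H : hilbertType R k) (a : R).

Lemma innerDl H (x y z : H) : ⟨x + y, z⟩ = ⟨x, z⟩ + ⟨y, z⟩.
Proof. exact: linearDl. Qed.

Lemma innerC H (x y : H) : ⟨x, y⟩ = scalar_conj R k ⟨y, x⟩.
Proof. by rewrite hermC expr0 mul1r. Qed.

Lemma innerZl H c (x y : H) : ⟨c *: x, y⟩ = c * ⟨x, y⟩.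
Proof. exact: linearZl_LR. Qed.

Lemma reDl H (x y z : H) : Re⟨x + y, z⟩ = Re⟨x, z⟩ + Re⟨y, z⟩.
Proof. by rewrite innerDl scalar_reD. Qed.

Lemma reC H (x y : H) : Re⟨x, y⟩ = Re⟨y, x⟩.
Proof. by rewrite innerC scalar_re_conj. Qed.

Lemma reZl H a (x y : H) : Re⟨a *r x, y⟩ = a * Re⟨x, y⟩.
Proof. by rewrite innerZl scalar_re_mul. Qed.

Lemma reDr H (x y z : H) : Re⟨x, y + z⟩ = Re⟨x, y⟩ + Re⟨x, z⟩.
Proof. by rewrite reC reDl !(reC x). Qed.

Lemma reZr H a (x y : H) : Re⟨x, a *r y⟩ = a * Re⟨x, y⟩.
Proof. by rewrite reC reZl reC. Qed.

Lemma scalerN1 H (x : H) : - x = -1 *r x.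
Proof. by rewrite scalar_of_realN scalar_of_real1 scaleN1r. Qed.

Lemma reNl H (x y : H) : Re⟨- x, y⟩ = - Re⟨x, y⟩.
Proof. by rewrite scalerN1 reZl mulN1r. Qed.

Lemma reNr H (x y : H) : Re⟨x, - y⟩ = - Re⟨x, y⟩.
Proof. by rewrite reC reNl reC. Qed.

Lemma re0l H (y : H) : Re⟨0, y⟩ = 0.
Proof. by apply: (addrI Re⟨0, y⟩); rewrite -reDl !addr0. Qed.

Lemma re0r H (y : H) : Re⟨y, 0⟩ = 0.
Proof. by rewrite reC re0l. Qed.

(** With [re_eqP] below, these rules reduce an identity between vectors to one
    between real numbers. *)
Definition reE := (reDl, reDr, reNl, reNr, reZl, reZr, re0l, re0r).

Lemma hnorm_of_real H (x : H) : scalar_of_real k `‖x‖ = `|x|.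
Proof. exact/scalar_ge0_real/normr_ge0. Qed.

Lemma hnorm_ge0 H (x : H) : 0 <= `‖x‖.
Proof. by rewrite -(scalar_of_real_ge0 (k := k)) hnorm_of_real. Qed.

Lemma hnorm_sqr H (x : H) : `‖x‖ ^+ 2 = Re⟨x, x⟩.
Proof.
by rewrite -sqr_norm_inner -hnorm_of_real !expr2 -scalar_of_realM scalar_of_realK.
Qed.

Lemma re_ge0 H (x : H) : 0 <= Re⟨x, x⟩.
Proof. by rewrite -hnorm_sqr sqr_ge0. Qed.

Lemma hnorm0 H : `‖0 : H‖ = 0.
Proof. by apply/eqP; rewrite -sqrf_eq0 hnorm_sqr re0l. Qed.

Lemma hnorm0_eq0 H (x : H) : `‖x‖ = 0 -> x = 0.
Proof.
move=> x0; apply/eqP; rewrite -normr_eq0 -hnorm_of_real x0.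
by case: k.
Qed.

Lemma hnormN H (x : H) : `‖- x‖ = `‖x‖.
Proof. by rewrite /hnorm normrN. Qed.

Lemma hdistC H (x y : H) : `‖x - y‖ = `‖y - x‖.
Proof. by rewrite -hnormN opprB. Qed.

Lemma hnormZ H a (x : H) : `‖a *r x‖ = `|a| * `‖x‖.
Proof.
apply/eqP; rewrite -(@eqrXn2 _ 2) ?mulr_ge0 ?hnorm_ge0//; apply/eqP.
by rewrite exprMn real_normK ?num_real// !hnorm_sqr !reE; ring.
Qed.

Lemma hnorm_gt0 H (x : H) : x != 0 -> 0 < `‖x‖.
Proof.
move=> x0; rewrite lt_def hnorm_ge0 andbT; apply: contra x0.
by move=> /eqP/hnorm0_eq0->.
Qed.

(** Expand the square of |y| x - |x| y. *)
Lemma re_le H (x y : H) : Re⟨x, y⟩ <= `‖x‖ * `‖y‖.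
Proof.
have [->|y0] := eqVneq y 0; first by rewrite re0r hnorm0 mulr0.
have [->|x0] := eqVneq x 0; first by rewrite re0l hnorm0 mul0r.
have := re_ge0 (`‖y‖ *r x - `‖x‖ *r y).
have := hnorm_gt0 x0; have := hnorm_gt0 y0.
rewrite !reE -!hnorm_sqr (reC y x) => yp xp h.
have := mulr_gt0 xp yp; nra.
Qed.

Lemma re_abs_le H (x y : H) : `|Re⟨x, y⟩| <= `‖x‖ * `‖y‖.
Proof.
by rewrite ler_norml lerNl -reNl -{1}(hnormN x) !re_le.
Qed.

Lemma hnormD H (x y : H) : `‖x + y‖ <= `‖x‖ + `‖y‖.
Proof.
rewrite -(@ler_pXn2r _ 2) ?nnegrE ?addr_ge0 ?hnorm_ge0//.
rewrite hnorm_sqr !reE -!hnorm_sqr (reC y x).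
have := re_le x y; nra.
Qed.

Lemma hnorm_triangle H (y x z : H) : `‖x - z‖ <= `‖x - y‖ + `‖y - z‖.
Proof. by rewrite -{1}(subrK y x) -addrA hnormD. Qed.

Lemma hnorm_duality H (x : H) (c : R) :
  0 <= c -> (forall y, Re⟨x, y⟩ <= c * `‖y‖) -> `‖x‖ <= c.
Proof.
move=> c0 h; have [->|x0] := eqVneq x 0; first by rewrite hnorm0.
by have := h x; rewrite -hnorm_sqr expr2 ler_pM2r// hnorm_gt0.
Qed.

Lemma re_eqP H (x y : H) : (forall h, Re⟨h, x⟩ = Re⟨h, y⟩) -> x = y.
Proof.
move=> h; apply/subr0_eq/hnorm0_eq0/eqP; rewrite -sqrf_eq0 hnorm_sqr.
by rewrite reDr reNr h subrr.
Qed.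

(** Applying the hypothesis to all the multiples [c *: h] recovers the
    imaginary part; [D] is the domain of a possibly unbounded operator. *)
Lemma inner_eq_re H (G : hilbertType R k) (f : H -> G) (x : G) y (D : set H) :
  (forall c h, D h -> D (c *: h)) -> (forall c h, D h -> f (c *: h) = c *: f h) ->
  (forall h, D h -> Re⟨f h, x⟩ = Re⟨h, y⟩) ->
  forall h, D h -> ⟨f h, x⟩ = ⟨h, y⟩.
Proof.
move=> DZ fZ e h Dh; apply: scalar_re_ext => c.
by rewrite -!innerZl -fZ// e//; exact: DZ.
Qed.

(** The next four statements express the topology of [H], which is given by a
    scalar-valued norm, through the real-valued one. *)
Lemma norm_lt_hnorm H (x y : H) (e : scalars R k) :
  0 < e -> (`|x - y| < e) = (`‖x - y‖ < scalar_re e).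
Proof.
move=> e0; rewrite -(scalar_ge0_real (ltW e0)) -hnorm_of_real -subr_gt0.
by rewrite -scalar_of_realN -scalar_of_realD scalar_of_real_gt0 subr_gt0 scalar_of_realK.
Qed.

Lemma cvg_hnormP T (F : set_system T) (FF : Filter F) H (f : T -> H) (l : H) :
  f @ F --> l <-> forall e : R, 0 < e -> \forall t \near F, `‖f t - l‖ < e.
Proof.
split=> [/cvgrPdist_lt h e e0|h].
  have e0' : 0 < scalar_of_real k e by rewrite scalar_of_real_gt0.
  apply: filterS (h _ e0') => t.
  by rewrite norm_lt_hnorm// scalar_of_realK hdistC.
apply/cvgrPdist_lt => e e0.
have e0' : 0 < scalar_re e.
  by rewrite -(scalar_of_real_gt0 (k := k)) scalar_ge0_real// ltW.
by apply: filterS (h _ e0') => t; rewrite norm_lt_hnorm// hdistC.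
Qed.

Lemma near_hnormP H (x : H) (P : set H) :
  (\forall y \near x, P y) <-> exists2 e : R, 0 < e & forall y, `‖y - x‖ < e -> P y.
Proof.
split.
  move=> /nbhs_normP[e /= e0 eP].
  exists (scalar_re e).
    by rewrite -(scalar_of_real_gt0 (k := k)) scalar_ge0_real// ltW.
  by move=> y xy; apply: eP; rewrite /= norm_lt_hnorm// hdistC.
move=> [e e0 eP]; apply/nbhs_normP; exists (scalar_of_real k e) => /=.
  by rewrite scalar_of_real_gt0.
move=> y /=; rewrite norm_lt_hnorm ?scalar_of_real_gt0// scalar_of_realK hdistC.
exact: eP.
Qed.

Lemma cauchy_hnorm_cvg H (u : nat -> H) :
  (forall e : R, 0 < e -> exists N, forall m n, (N <= m)%N -> (N <= n)%N -> `‖u m - u n‖ < e) ->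
  exists l : H, forall e : R, 0 < e -> exists N, forall n, (N <= n)%N -> `‖u n - l‖ < e.
Proof.
move=> h; have /cvg_ex[l ul] : cvg (u @ \oo).
  apply/cauchy_cvgP/cauchy_ballP => e e0.
  have e0' : 0 < scalar_re e.
    by rewrite -(scalar_of_real_gt0 (k := k)) scalar_ge0_real// ltW.
  have [N hN] := h _ e0'.
  rewrite near_map2; near=> m n.
  rewrite -ball_normE /= norm_lt_hnorm//; apply: hN.
    by near: m; exact: nbhs_infty_ge.
  by near: n; exact: nbhs_infty_ge.
exists l => e e0; have /cvg_hnormP/(_ _ e0)[N _ hN] := ul.
by exists N => n Nn; exact: hN.
Unshelve. all: end_near. Qed.

End real_inner_product.

(** * Minimization and the Riesz representation *)

Section riesz.
Context {R : realType} {k : scalar_kind}.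
Implicit Types (H G : hilbertType R k).

(** For small [t] of either sign the linear term dominates. *)
Lemma quadratic_ge0_linear0 (a b : R) : (forall t, 0 <= t ^+ 2 * a + t * b) -> b = 0.
Proof.
move=> h; set s := (1 + `|a|)^-1.
have s1 : 0 < 1 + `|a| by rewrite ltr_pwDl.
have s0 : 0 < s by rewrite invr_gt0.
have sa : s * a < 1.
  by rewrite mulrC ltr_pdivrMr// mul1r (le_lt_trans (ler_norm a))// ltrDr.
have := h (- (b * s)); rewrite (_ : _ + _ = - (s * (b ^+ 2 * (1 - s * a)))); last by ring.
rewrite oppr_ge0 pmulr_rle0// pmulr_lle0 ?subr_gt0// => b0.
by apply/eqP; rewrite -sqrf_eq0 eq_le b0 sqr_ge0.
Qed.

(** The functional J x = |S x|^2 + 2 f x need not attain its infimum, since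
    [S] need not have closed range.  Along a minimizing sequence the vectors
    S x still converge, by the parallelogram law, and the first-order condition
    at their limit l is Re <l, S h> + f h = 0.  For S = id this is the Riesz
    representation; for S a square root of P it places in ran S every vector w
    for which <P x, x> + 2 Re <w, x> is bounded below. *)
Lemma minimizer_representation G H (S : G -> H) (f : G -> R) (c : R) :
  (forall x y, S (x + y) = S x + S y) -> (forall a x, S (a *r x) = a *r S x) ->
  (forall x y, f (x + y) = f x + f y) -> (forall (a : R) x, f (a *r x) = a * f x) ->
  (forall x, c <= `‖S x‖ ^+ 2 + 2 * f x) ->
  exists q, forall h, f h = Re⟨q, S h⟩.
Proof.
move=> SD SZ fD fZ lb.
pose J x := `‖S x‖ ^+ 2 + 2 * f x; pose m := inf (range J).
have infJ : has_inf (range J).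
  by split; [exists (J 0), 0 | exists c => _ [x _ <-]; exact: lb].
have mJ x : m <= J x by apply: ge_inf; [exact: infJ.2|exists x].
have JZ t x h : J (x + t *r h) =
    J x + t ^+ 2 * `‖S h‖ ^+ 2 + 2 * t * (Re⟨S x, S h⟩ + f h).
  by rewrite /J SD SZ fD fZ !hnorm_sqr !reE (reC (S h)); ring.
have near_min (n : nat) : exists x, J x < m + n.+1%:R^-1.
  have n0 : (0 : R) < n.+1%:R^-1 by rewrite invr_gt0.
  have [_ [x _ <-] xm] := inf_adherent n0 infJ.
  by exists x.
have [x xm] := choice near_min.
have small (e : R) : 0 < e -> exists N, forall n, (N <= n)%N -> J (x n) < m + e.
  move=> e0; exists (Num.truncn e^-1) => n Nn; apply: (lt_le_trans (xm n)).
  rewrite lerD2l invf_ple ?posrE// (le_trans (ltW (truncnS_gt _)))// ler_nat.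
  by rewrite ltnS.
have close y z e : J y < m + e -> J z < m + e -> `‖S y - S z‖ ^+ 2 < 4 * e.
  (* the midpoint of [y] and [z] cannot do better than the infimum *)
  move=> ye ze; have := mJ (y + 2^-1 *r (z - y)).
  rewrite JZ; have -> : S (z - y) = S z - S y by rewrite SD scalerN1 SZ -scalerN1.
  have -> : f (z - y) = f z - f y by rewrite fD scalerN1 fZ mulN1r.
  by move: ye ze; rewrite /J !hnorm_sqr !reE (reC (S z)); lra.
have [|l xl] := @cauchy_hnorm_cvg _ _ H (S \o x).
  move=> e e0; have e4 : 0 < e ^+ 2 / 4 by rewrite divr_gt0// exprn_gt0.
  have [N hN] := small _ e4; exists N => i j Ni Nj.
  rewrite -(@ltr_pXn2r _ 2) ?nnegrE ?hnorm_ge0// ?ltW//.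
  by apply: (lt_le_trans (close _ _ _ (hN _ Ni) (hN _ Nj))); lra.
exists (- l) => h; apply/eqP; rewrite reE -subr_eq0 opprK addrC; apply/eqP.
suff /quadratic_ge0_linear0/eqP : forall t, 0 <= t ^+ 2 * `‖S h‖ ^+ 2 +
    t * (2 * (Re⟨l, S h⟩ + f h)).
  by rewrite mulf_eq0 pnatr_eq0 /= => /eqP.
(* The claim is the limit of J (x n + t h) - J (x n) >= - d; if it failed, [d]
   below would be small enough to contradict this inequality at a finite [n]. *)
move=> t; rewrite leNgt; apply/negP => neg.
set E := t ^+ 2 * _ + _ in neg.
pose d := - E / (2 * (1 + 2 * `|t| * `‖S h‖)).
have den : 0 < 1 + 2 * `|t| * `‖S h‖.
  by rewrite ltr_pwDl// mulr_ge0 ?hnorm_ge0// mulr_ge0.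
have d0 : 0 < d by rewrite divr_gt0 ?mulr_gt0// oppr_gt0.
have dE : d * (1 + 2 * `|t| * `‖S h‖) = - E / 2 by rewrite /d; field; lra.
have [N1 h1] := small _ d0; have [N2 h2] := xl _ d0.
pose n := maxn N1 N2.
have := mJ (x n + t *r h); rewrite JZ.
have := h1 n (leq_maxl _ _); have := h2 n (leq_maxr _ _).
rewrite /= => p1 p2 p3.
have p4 : t * (Re⟨S (x n), S h⟩ - Re⟨l, S h⟩) <= `|t| * (d * `‖S h‖).
  rewrite -reNl -reDl (le_trans (ler_norm _))// normrM ler_wpM2l//.
  by rewrite (le_trans (re_abs_le _ _))// ler_wpM2r ?hnorm_ge0 ?ltW.
move: dE p4 p3 p2 neg; rewrite /E; nra.
Qed.

(** Here |x|^2 + 2 f x >= (|x| - M)^2 - M^2. *)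
Lemma real_riesz H (f : H -> R) (M : R) :
  (forall x y, f (x + y) = f x + f y) -> (forall (a : R) x, f (a *r x) = a * f x) ->
  (forall x, `|f x| <= M * `‖x‖) ->
  exists q, forall h, f h = Re⟨q, h⟩.
Proof.
move=> fD fZ fM.
apply: (@minimizer_representation H H id f (- M ^+ 2)) => // x.
have := fM x; rewrite ler_norml => /andP[h _]; have := sqr_ge0 (`‖x‖ - M); nra.
Qed.

Lemma boundedD H G (f : {bounded H -> G}) x y : f (x + y) = f x + f y.
Proof. exact: linearD. Qed.

Lemma boundedB H G (f : {bounded H -> G}) x y : f (x - y) = f x - f y.
Proof. exact: linearB. Qed.

Lemma boundedZ H G (f : {bounded H -> G}) c x : f (c *: x) = c *: f x.
Proof. exact: linearZ. Qed.

Lemma bounded0 H G (f : {bounded H -> G}) : f 0 = 0.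
Proof. exact: linear0. Qed.

(** Continuity at 0, rescaled. *)
Lemma bounded_operator_le H G (f : {bounded H -> G}) :
  exists2 M : R, 0 < M & forall x, `‖f x‖ <= M * `‖x‖.
Proof.
have /near_hnormP[] : \forall y \near (0 : H), `‖f y - f 0‖ < 1.
  have /cvg_hnormP := @cts_fun _ _ f 0; exact.
move=> e e0 he; exists (2 / e) => [|x]; first by rewrite divr_gt0.
have [->|x0] := eqVneq x 0; first by rewrite linear0 !hnorm0 mulr0.
have xp := hnorm_gt0 x0.
have /he : `‖(e / 2 / `‖x‖) *r x - 0‖ < e.
  rewrite subr0 hnormZ ger0_norm; last by rewrite !divr_ge0// ltW.
  by rewrite divfK ?gt_eqF//; lra.
rewrite linear0 subr0 linearZ /= hnormZ ger0_norm; last by rewrite !divr_ge0// ltW.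
move=> h; have c0 : 0 < e / 2 / `‖x‖ by rewrite !divr_gt0.
rewrite -(ler_pM2l c0); apply: (le_trans (ltW h)).
by rewrite le_eqVlt; apply/orP; left; apply/eqP; field; rewrite !gt_eqF.
Qed.

Lemma bounded_operator_build H G (f : H -> G) (M : R) :
  linear f -> (forall x, `‖f x‖ <= M * `‖x‖) ->
  exists Q : {bounded H -> G}, Q = f :> (H -> G).
Proof.
move=> lf fM; pose fl : {linear H -> G} := HB.pack f (GRing.isLinear.Build _ _ _ _ _ lf).
have fc : continuous f.
  move=> x; apply/cvg_hnormP => e e0; apply/near_hnormP.
  have M1 : 0 < 1 + `|M| by rewrite ltr_pwDl.
  exists (e / (1 + `|M|)) => [|y]; first by rewrite divr_gt0.
  rewrite ltr_pdivlMr// => h; have -> : f y - f x = f (y - x) by rewrite -[f]/(fl : H -> G) linearB.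
  have := fM (y - x); have := ler_norm M; have := hnorm_ge0 (y - x); nra.
pose Q : {bounded H -> G} := HB.pack f (GRing.isLinear.Build _ _ _ _ _ lf)
  (isContinuous.Build _ _ _ fc).
by exists Q.
Qed.

Lemma bounded_adjointP H G (f : {bounded H -> G}) x y :
  ⟨f x, y⟩ = ⟨x, bounded_adjoint f y⟩.
Proof.
have [M M0 fM] := bounded_operator_le f.
have [|||q hq] := @real_riesz _ (fun x => Re⟨f x, y⟩) (M * `‖y‖).
- by move=> u v; rewrite linearD reE.
- by move=> a u; rewrite linearZ reE.
- move=> u; apply: (le_trans (re_abs_le _ _)).
  by rewrite mulrAC ler_wpM2r// hnorm_ge0.
have : adjoint_value (PartialOperator setT f) y q.
  apply: inner_eq_re => // [c h _|h _ /=]; first by rewrite /= linearZ.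
  by rewrite hq reC.
by move=> /(xgetI 0); apply.
Qed.

Lemma bounded_adjoint_eq H G (f : {bounded H -> G}) y w :
  (forall x, Re⟨f x, y⟩ = Re⟨x, w⟩) -> bounded_adjoint f y = w.
Proof. by move=> h; apply: re_eqP => x; rewrite -bounded_adjointP h. Qed.

(** The adjoint of a bounded operator is total, so an operator that equals its
    adjoint is symmetric, and conversely. *)
Lemma self_adjointP H (P : {bounded H -> H}) :
  self_adjoint P <-> forall x y, Re⟨P x, y⟩ = Re⟨x, P y⟩.
Proof.
split=> [h x y|h]; first by rewrite bounded_adjointP h.
by apply/funext => y; exact: bounded_adjoint_eq.
Qed.

Lemma self_adjoint_real H (P : {bounded H -> H}) x :
  self_adjoint P -> scalar_of_real k Re⟨P x, x⟩ = ⟨P x, x⟩.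
Proof.
by move=> h; apply: scalar_real_of_conj; rewrite -innerC -{1}h -bounded_adjointP.
Qed.

Lemma nonnegativeP H (P : {bounded H -> H}) : self_adjoint P ->
  nonnegative P <-> forall x, 0 <= Re⟨P x, x⟩.
Proof.
move=> sP; split=> h x; have := h x; rewrite -(self_adjoint_real x sP);
  by rewrite scalar_of_real_ge0 ?scalar_of_realK.
Qed.
End riesz.

(** * Square roots of non-negative operators *)

Section square_root.
Context {R : realType} {k : scalar_kind} {H : hilbertType R k}.
Implicit Types (B Y P : H -> H).

(** A fixed point Z of this iteration satisfies (1 - Z)^2 = 1 - B. *)
Fixpoint root_iter (B : H -> H) (n : nat) (x : H) : H :=
  if n is m.+1 then 2^-1 *r (B x + root_iter B m (root_iter B m x)) else 0.

(** The same iteration for the number B = 1, which dominates the operator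
    iterates of a contraction. *)
Fixpoint root_majorant (n : nat) : R :=
  if n is m.+1 then 2^-1 * (1 + root_majorant m ^+ 2) else 0.

(** The error e = 1 - r evolves by e := e - e^2 / 2, a map that increases on
    the unit interval and sends 2 / (n + 2) below 2 / (n + 3). *)
Lemma root_majorant_bounds n :
  [/\ 0 <= root_majorant n, root_majorant n <= 1 &
      1 - root_majorant n <= 2 / n.+2%:R].
Proof.
elim: n => [|n [r0 r1 rn]] /=; first by split; lra.
move: (root_majorant n) r0 r1 rn => r r0 r1 rn; split; [nra|nra|].
have -> : 1 - 2^-1 * (1 + r ^+ 2) = (1 - r) - (1 - r) ^+ 2 / 2 by field.
have n2 : n.+2%:R = n%:R + 2 :> R by rewrite -addn2 natrD.
have n3 : n.+3%:R = n%:R + 3 :> R by rewrite -addn3 natrD.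
have n0 : (0 : R) <= n%:R by [].
move: rn; rewrite n2 n3; move: (n%:R : R) n0 => v v0 rn.
have rn1 : 2 / (v + 2) <= 1 by rewrite ler_pdivrMr; lra.
apply: (@le_trans _ _ (2 / (v + 2) - (2 / (v + 2)) ^+ 2 / 2)).
  by move: rn rn1; move: (2 / (v + 2)) => w rn rn1; nra.
rewrite -subr_ge0 (_ : _ - _ = 2 / ((v + 3) * (v + 2) ^+ 2)); last first.
  by field; rewrite !gt_eqF//; lra.
by rewrite divr_ge0// mulr_ge0 ?sqr_ge0//; lra.
Qed.

Lemma root_majorant_homo n p : root_majorant n <= root_majorant (n + p).
Proof.
elim: p => [|p h]; first by rewrite addn0.
apply: (le_trans h); rewrite addnS /=; set r := root_majorant _.
by have := sqr_ge0 (1 - r); nra.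
Qed.

Lemma root_iter_linear B n : linear B -> linear (root_iter B n).
Proof.
move=> lB; elim: n => [|n ih] a x y /=; first by rewrite scaler0 addr0.
by rewrite lB !ih addrACA -scalerDr [LHS]scalerDr !scalerA (mulrC a).
Qed.

Section contraction.
Variable B : H -> H.
Hypothesis B_linear : linear B.
Hypothesis B_sym : forall x y, Re⟨B x, y⟩ = Re⟨x, B y⟩.
Hypothesis B_le : forall x, `‖B x‖ <= `‖x‖.

Local Notation Y := (root_iter B).
Local Notation r := root_majorant.

Lemma root_iterB n x y : Y n (x - y) = Y n x - Y n y.
Proof.
pose f : {linear H -> H} :=
  HB.pack (Y n) (GRing.isLinear.Build _ _ _ _ _ (root_iter_linear n B_linear)).
exact: (linearB f).
Qed.

Lemma root_iter_sym n x y : Re⟨Y n x, y⟩ = Re⟨x, Y n y⟩.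
Proof.
elim: n x y => [|n ih] x y /=; first by rewrite !reE.
by rewrite !reE B_sym !ih.
Qed.

Lemma root_iter_le n x : `‖Y n x‖ <= r n * `‖x‖.
Proof.
elim: n x => [|n ih] x /=; first by rewrite hnorm0 mul0r.
rewrite hnormZ ger0_norm ?invr_ge0// -mulrA ler_wpM2l ?invr_ge0//.
apply: (le_trans (hnormD _ _)); rewrite mulrDl mul1r lerD//.
apply: (le_trans (ih _)); rewrite expr2 -mulrA ler_wpM2l//.
by have [] := root_majorant_bounds n.
Qed.

(** The splitting Y'^2 - Y^2 = Y' (Y' - Y) + (Y' - Y) Y holds without any
    commutation, and bounds the operator increments by those of the
    majorant. *)
Lemma root_iter_step n x : `‖Y n.+1 x - Y n x‖ <= (r n.+1 - r n) * `‖x‖.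
Proof.
elim: n x => [|n ih] x.
  by have := root_iter_le 1 x; rewrite /= !subr0.
have -> : Y n.+2 x - Y n.+1 x = 2^-1 *r
    (Y n.+1 (Y n.+1 x - Y n x) + (Y n.+1 (Y n x) - Y n (Y n x))).
  rewrite root_iterB -[Y n.+2 x]/(2^-1 *r (B x + Y n.+1 (Y n.+1 x))).
  rewrite addrA subrK [in X in _ - X = _]/= -scalerBr opprD addrACA subrr add0r.
  by [].
rewrite hnormZ ger0_norm ?invr_ge0//.
have h1 := hnormD (Y n.+1 (Y n.+1 x - Y n x)) (Y n.+1 (Y n x) - Y n (Y n x)).
have h2 := root_iter_le n.+1 (Y n.+1 x - Y n x).
have h3 := ih (Y n x); have h4 := ih x; have h5 := root_iter_le n x.
have h6 := root_majorant_homo n 1; rewrite addn1 in h6.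
have [h7 _ _] := root_majorant_bounds n.+1.
have h8 := ler_wpM2l h7 h4.
rewrite -subr_ge0 in h6; have h9 := ler_wpM2l h6 h5.
have -> : r n.+2 - r n.+1 = 2^-1 * (r n.+1 + r n) * (r n.+1 - r n).
  have e : r n.+1 = 2^-1 * (1 + r n ^+ 2) by [].
  by rewrite -[r n.+2]/(2^-1 * (1 + r n.+1 ^+ 2)); move: (r n.+1) e => a; lra.
by rewrite -!mulrA ler_wpM2l ?invr_ge0//; lra.
Qed.

Lemma root_iter_cauchy n p x : `‖Y (n + p) x - Y n x‖ <= (1 - r n) * `‖x‖.
Proof.
suff h : `‖Y (n + p) x - Y n x‖ <= (r (n + p)%N - r n) * `‖x‖.
  apply: (le_trans h); rewrite ler_wpM2r ?hnorm_ge0// lerD2r.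
  by have [] := root_majorant_bounds (n + p).
elim: p => [|p ih]; first by rewrite addn0 !subrr hnorm0 mul0r.
apply: (le_trans (hnorm_triangle (Y (n + p)%N x) _ _)).
rewrite addnS; have := root_iter_step (n + p) x; move: ih; nra.
Qed.

Lemma root_majorant_small (e c : R) : 0 < e -> 0 <= c ->
  exists n, (1 - r n) * c < e.
Proof.
move=> e0 c0; exists (Num.truncn (2 * c / e)).
set n := Num.truncn _; have [_ _ rn] := root_majorant_bounds n.
apply: (le_lt_trans (ler_wpM2r c0 rn)).
rewrite mulrAC ltr_pdivrMr// -ltr_pdivrMl// mulrC.
by apply: (lt_trans (truncnS_gt _)); rewrite ltr_nat.
Qed.

Lemma root_limit : exists Z : H -> H, forall n x, `‖Z x - Y n x‖ <= (1 - r n) * `‖x‖.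
Proof.
suff /choice[Z hZ] : forall x, exists l, forall n, `‖l - Y n x‖ <= (1 - r n) * `‖x‖.
  by exists Z => n x.
move=> x; have [|l hl] := @cauchy_hnorm_cvg _ _ H (Y ^~ x).
  move=> e e0; have e2 : 0 < e / 2 by rewrite divr_gt0.
  have [N hN] := root_majorant_small e2 (hnorm_ge0 x); exists N => m n Nm Nn.
  apply: (le_lt_trans (hnorm_triangle (Y N x) _ _)); rewrite (hdistC (Y N x)).
  have := root_iter_cauchy N (m - N) x; have := root_iter_cauchy N (n - N) x.
  rewrite !subnKC//; lra.
exists l => n; rewrite leNgt; apply/negP => lt.
rewrite -subr_gt0 in lt; have [N hN] := hl _ lt.
have := hN _ (leq_addl n N); have := root_iter_cauchy n N x.
by have := hnorm_triangle (Y (n + N)%N x) l (Y n x); rewrite (hdistC l (Y (n + N)%N x)); lra.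
Qed.

Lemma le0_majorant (a c : R) : 0 <= c -> (forall n, a <= (1 - r n) * c) -> a <= 0.
Proof.
move=> c0 h; rewrite leNgt; apply/negP => a0.
by have [n] := root_majorant_small a0 c0; have := h n; lra.
Qed.

(** The limit Z of the iterates satisfies Z^2 = 2 Z - B, so Q = 1 - Z is a
    square root of 1 - B; it is non-negative because Z is a contraction. *)
Lemma sqrt_one_minus : exists Q : {bounded H -> H},
  [/\ self_adjoint Q, nonnegative Q & forall x, Q (Q x) = x - B x].
Proof.
have [Z hZ] := root_limit.
have Zcvg x : Y n x @[n --> \oo] --> Z x.
  apply/cvg_hnormP => e e0; have [N hN] := root_majorant_small e0 (hnorm_ge0 x).
  exists N => // n /= Nn; rewrite hdistC; apply: (le_lt_trans (hZ n x)).
  apply: le_lt_trans hN; rewrite ler_wpM2r ?hnorm_ge0// lerD2l lerN2.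
  by have := root_majorant_homo N (n - N); rewrite subnKC.
have Zlin : linear Z.
  move=> a x y; apply: (cvg_unique (@norm_hausdorff _ H) (Zcvg _)).
  rewrite (_ : (fun n => _) = (fun n => a *: Y n x + Y n y)); last first.
    by apply/funext => n; rewrite root_iter_linear.
  by apply: cvgD => //; apply: cvgZr.
have Zsym x y : Re⟨Z x, y⟩ = Re⟨x, Z y⟩.
  apply/eqP; rewrite -subr_eq0 -normr_le0.
  apply: (@le0_majorant _ (2 * (`‖x‖ * `‖y‖))) => [|n].
    by rewrite !mulr_ge0 ?hnorm_ge0.
  have -> : Re⟨Z x, y⟩ - Re⟨x, Z y⟩ = Re⟨Z x - Y n x, y⟩ - Re⟨x, Z y - Y n y⟩.
    by rewrite !reE root_iter_sym; ring.
  apply: (le_trans (ler_normB _ _)).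
  have := re_abs_le (Z x - Y n x) y; have := re_abs_le x (Z y - Y n y).
  have := ler_wpM2r (hnorm_ge0 y) (hZ n x).
  have := ler_wpM2l (hnorm_ge0 x) (hZ n y); lra.
have Zle x : `‖Z x‖ <= `‖x‖ by have := hZ 0%N x; rewrite /= !subr0 mul1r.
have Zeq x : Z (Z x) = 2 *r Z x - B x.
  apply/subr0_eq/hnorm0_eq0/le_anti; rewrite hnorm_ge0 andbT.
  apply: (@le0_majorant _ (4 * `‖x‖)) => [|n].
    by rewrite mulr_ge0 ?hnorm_ge0.
  have -> : Z (Z x) - (2 *r Z x - B x) =
      (Z (Z x) - Y n (Z x)) + Y n (Z x - Y n x) + 2 *r (Y n.+1 x - Z x).
    by apply: re_eqP => h; rewrite root_iterB /= !reE; lra.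
  apply: (le_trans (hnormD _ _)); rewrite hnormZ ger0_norm//.
  have := hnormD (Z (Z x) - Y n (Z x)) (Y n (Z x - Y n x)).
  have [r0 r1 _] := root_majorant_bounds n.
  have := root_iter_le n (Z x - Y n x); have := hZ n (Z x); have := hZ n x.
  have := hZ n.+1 x; rewrite hdistC.
  have := root_majorant_homo n 1; rewrite addn1.
  have := Zle x; have := hnorm_ge0 x; have := hnorm_ge0 (Z x - Y n x).
  move: (r n.+1) => r'; nra.
have Qlin : linear (fun x => x - Z x).
  by move=> a x y; rewrite Zlin scalerBr opprD addrACA.
have Qle x : `‖x - Z x‖ <= 2 * `‖x‖.
  by have := hnormD x (- Z x); have := Zle x; rewrite hnormN; lra.
have [Q QE] := bounded_operator_build Qlin Qle.
have Qs : self_adjoint Q.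
  by apply/self_adjointP => x y; rewrite QE !reE Zsym.
exists Q; split=> //.
  apply/nonnegativeP => // x; rewrite QE !reE subr_ge0 -hnorm_sqr.
  apply: (le_trans (re_le _ _)); rewrite expr2 ler_wpM2r ?hnorm_ge0//.
move=> x; rewrite QE.
have -> : Z (x - Z x) = Z x - Z (Z x).
  pose f : {linear H -> H} := HB.pack Z (GRing.isLinear.Build _ _ _ _ _ Zlin).
  exact: (linearB f).
by rewrite Zeq; apply: re_eqP => h; rewrite !reE; lra.
Qed.

End contraction.

(** Write P = M (1 - B) with M a bound of P and B = 1 - P / M.  The estimate
    |P x|^2 <= M <P x, x> makes B a contraction, as
    |B x|^2 = |x|^2 - 2 <P x, x> / M + |P x|^2 / M^2. *)
Lemma sqrt_exists (P : {bounded H -> H}) : self_adjoint P -> nonnegative P ->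
  exists Q : {bounded H -> H},
    [/\ self_adjoint Q, nonnegative Q & forall x, Q (Q x) = P x].
Proof.
move=> sP /(nonnegativeP sP) P0; have /self_adjointP Psym := sP.
have [M M0 PM] := bounded_operator_le P.
pose B x := x - M^-1 *r P x.
have P2 x : `‖P x‖ ^+ 2 <= M * Re⟨P x, x⟩.
  (* non-negativity of P at the vector x - P x / M *)
  have PE : P (x - M^-1 *r P x) = P x - M^-1 *r P (P x) by rewrite linearB linearZ.
  have := P0 (x - M^-1 *r P x); rewrite PE !reE.
  rewrite (Psym (P x) x) -!hnorm_sqr.
  have h : Re⟨P (P x), P x⟩ <= M * `‖P x‖ ^+ 2.
    apply: (le_trans (re_le _ _)); rewrite expr2 mulrA ler_wpM2r ?hnorm_ge0//.
  have MV : M^-1 * M = 1 by rewrite mulVf// gt_eqF.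
  have MV0 : 0 < M^-1 by rewrite invr_gt0.
  have := ler_wpM2l (ltW MV0) (ler_wpM2l (ltW MV0) h).
  rewrite (mulrA M^-1 M) MV mul1r => h1 h2.
  have h3 : M^-1 * `‖P x‖ ^+ 2 <= Re⟨P x, x⟩ by lra.
  by have := ler_wpM2l (ltW M0) h3; rewrite mulrA mulfV ?gt_eqF// mul1r.
have [|||Q [Qs Q0 QQ]] := @sqrt_one_minus B.
- by move=> a x y; rewrite /B linearP !scalerDr scalerN opprD addrACA !scalerA (mulrC a).
- by move=> x y; rewrite /B !reE Psym.
- move=> x; rewrite -(@ler_pXn2r _ 2) ?nnegrE ?hnorm_ge0//.
  rewrite [leLHS]hnorm_sqr !reE -!hnorm_sqr (reC x).
  have MV0 : 0 < M^-1 by rewrite invr_gt0.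
  have := ler_wpM2l (ltW MV0) (ler_wpM2l (ltW MV0) (P2 x)).
  rewrite (mulrA M^-1 M) mulVf ?gt_eqF// mul1r.
  have := mulr_ge0 (ltW MV0) (P0 x); lra.
have slin : linear (fun x => Num.sqrt M *r Q x).
  by move=> a x y; rewrite linearP scalerDr !scalerA (mulrC a).
have [N N0 QN] := bounded_operator_le Q.
have sle x : `‖Num.sqrt M *r Q x‖ <= Num.sqrt M * N * `‖x‖.
  by rewrite hnormZ ger0_norm ?sqrtr_ge0// -mulrA ler_wpM2l ?sqrtr_ge0.
have [S SE] := bounded_operator_build slin sle.
have Ss : self_adjoint S.
  apply/self_adjointP => x y; rewrite SE !reE; congr (_ * _).
  by have /self_adjointP := Qs; apply.
exists S; split=> //.
  apply/nonnegativeP => // x; rewrite SE !reE mulr_ge0 ?sqrtr_ge0//.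
  exact: (proj1 (nonnegativeP Qs) Q0).
move=> x; rewrite SE linearZ /= scalerA -scalar_of_realM -expr2 sqr_sqrtr ?ltW// QQ.
rewrite /B opprB addrC subrK scalerA -scalar_of_realM mulfV ?gt_eqF//.
by rewrite scalar_of_real1 scale1r.
Qed.

(** [nonneg_sqrt] selects a square root; which one is immaterial once one is
    known to exist. *)
Lemma nonneg_sqrtP (P : {bounded H -> H}) : self_adjoint P -> nonnegative P ->
  exists Q : {bounded H -> H},
    [/\ nonneg_sqrt P = Q, self_adjoint Q & forall x, Q (Q x) = P x].
Proof.
move=> sP P0; have [Q [Qs Q0 QQ]] := sqrt_exists sP P0.
have : [set S : H -> H | exists Q : {bounded H -> H},
    [/\ S = Q, self_adjoint Q, nonnegative Q & Q \o Q = P]] Q.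
  by exists Q; split=> //; apply/funext.
move=> /(xgetI (fun=> 0))[S [SE Ss _ SS]]; exists S; split=> // x.
by rewrite -SS.
Qed.

End square_root.

(** * A quantitative uniform boundedness principle *)

Section uniform_boundedness.
Context {R : realType} {k : scalar_kind}.
Implicit Types (H G : hilbertType R k).

(** [N] is the operator norm.  The factor 2/3 only has to exceed the 1/2 that
    the tail of a geometric series consumes in [gliding_hump]. *)
Lemma near_norming H G (F : {bounded H -> G}) : exists (N : R) (y : H),
  [/\ 0 <= N, forall x, `‖F x‖ <= N * `‖x‖, `‖y‖ <= 1 & 2 / 3 * N <= `‖F y‖].
Proof.
have [M M0 FM] := bounded_operator_le F.
pose E := [set r | exists2 y : H, `‖y‖ <= 1 & `‖F y‖ = r].
have E0 : E 0 by exists 0; rewrite ?linear0 hnorm0.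
have supE : has_sup E.
  split; first by exists 0.
  by exists M => _ [y y1 <-]; apply: (le_trans (FM y)); rewrite ler_piMr// ltW.
have FE y : `‖y‖ <= 1 -> `‖F y‖ <= sup E.
  by move=> y1; apply: sup_upper_bound => //; exists y.
have s0 : 0 <= sup E by apply: sup_upper_bound.
have Fsup x : `‖F x‖ <= sup E * `‖x‖.
  have [->|x0] := eqVneq x 0; first by rewrite linear0 !hnorm0 mulr0.
  have xp := hnorm_gt0 x0; have xV : 0 < `‖x‖^-1 by rewrite invr_gt0.
  have := FE (`‖x‖^-1 *r x).
  rewrite linearZ /= !hnormZ ger0_norm ?invr_ge0 ?hnorm_ge0//.
  rewrite mulVf ?gt_eqF// lexx => /(_ isT).
  by rewrite ler_pdivrMl// mulrC.
exists (sup E); have [s00|sp] := eqVneq (sup E) 0.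
  by exists 0; split; rewrite // ?hnorm0 ?s00 ?mulr0 ?hnorm_ge0.
have {}sp : 0 < sup E / 3 by rewrite divr_gt0// lt_def sp.
have [_ [y y1 <-] ys] := sup_adherent sp supE.
by exists y; split=> //; lra.
Qed.

(** One vector x nearly realizes the norm of all the F n at once.  It is a sum
    of terms +- 3^-n y n with y n of norm at most 1 and nearly norming for F n.  The
    sign is chosen so that F n has norm at least 3^-n |F n (y n)| at the partial
    sum, that is at least 2/3 of 3^-n |F n|; the later terms have total length at most
    3^-n / 2, so that 3^-n |F n| / 6 remains. *)
Lemma gliding_hump H G (F : nat -> {bounded H -> G}) :
  exists x, forall n y, `‖F n y‖ <= 6 * 3 ^+ n * `‖F n x‖ * `‖y‖.
Proof.
have /choice[N /choice[y hNy]] := fun n => near_norming (F n).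
have sgn n x : exists b : bool, `‖F n (y n)‖ <= 3 ^+ n *
    `‖F n (x + ((-1) ^+ b / 3 ^+ n) *r y n)‖.
  have p3 : 0 < 3 ^+ n :> R by rewrite exprn_gt0.
  set s := 3 ^+ n in p3 *.
  rewrite [X in exists b, _ <= X b](_ : _ = fun b : bool =>
      `‖s *r F n x + (-1) ^+ b *r F n (y n)‖); last first.
    apply/funext => b; rewrite -[X in X * _](ger0_norm (ltW p3)) -hnormZ.
    rewrite linearD linearZ /=; congr `‖_‖; apply: re_eqP => h; rewrite !reE.
    by field; rewrite gt_eqF.
  (* of two vectors at distance 2 |F n (y n)| one has norm at least
     |F n (y n)| *)
  have := hnormD (s *r F n x + 1 *r F n (y n)) (- (s *r F n x + (-1) *r F n (y n))).
  have -> : s *r F n x + 1 *r F n (y n) - (s *r F n x + (-1) *r F n (y n)) =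
    2 *r F n (y n) by apply: re_eqP => h; rewrite !reE; lra.
  rewrite hnormN hnormZ ger0_norm// => h.
  have [h1|h1] := leP `‖F n (y n)‖ `‖s *r F n x + 1 *r F n (y n)‖.
    by exists false; rewrite expr0.
  by exists true; rewrite expr1; lra.
have /choice[b hb] : forall nx : nat * H, exists b : bool, `‖F nx.1 (y nx.1)‖ <=
    3 ^+ nx.1 * `‖F nx.1 (nx.2 + ((-1) ^+ b / 3 ^+ nx.1) *r y nx.1)‖.
  by move=> [n x]; exact: sgn.
pose u := fix u n := if n is m.+1 then
  u m + ((-1) ^+ (b (m, u m)) / 3 ^+ m) *r y m else 0.
have p3 n : 0 < 3 ^+ n :> R by rewrite exprn_gt0.
have step n : `‖u n.+1 - u n‖ <= 1 / 3 ^+ n.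
  rewrite /= addrAC subrr add0r hnormZ normrM normr_sign mul1r ger0_norm.
    by rewrite div1r ler_piMr ?invr_ge0 ?(ltW (p3 n))//; have [] := hNy n.
  by rewrite invr_ge0 ltW.
have tail n p : `‖u (n + p)%N - u n‖ <= 3 / 2 / 3 ^+ n - 3 / 2 / 3 ^+ (n + p).
  elim: p => [|p ih]; first by rewrite addn0 !subrr hnorm0.
  apply: (le_trans (hnorm_triangle (u (n + p)%N) _ _)); rewrite addnS.
  have := step (n + p)%N; rewrite exprS invfM; move: ih.
  by move: (_ ^- (n + p)) => w; lra.
have tail' n p : `‖u (n + p)%N - u n‖ <= 3 / 2 / 3 ^+ n.
  by apply: (le_trans (tail n p)); rewrite gerBl !divr_ge0// ltW// p3.
have pow3 n : n.+1%:R <= 3 ^+ n :> R.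
  by rewrite -natrX ler_nat ltn_expl.
have [e e0|x hx] := @cauchy_hnorm_cvg _ _ _ u.
  exists (Num.truncn (3 / e)) => i j; set n := Num.truncn _ => ni nj.
  apply: (le_lt_trans (hnorm_triangle (u n) _ _)); rewrite (hdistC (u n)).
  have := tail' n (i - n)%N; have := tail' n (j - n)%N; rewrite !subnKC// => h1 h2.
  suff : 3 / 3 ^+ n < e by lra.
  rewrite ltr_pdivrMr// -ltr_pdivrMl// mulrC.
  by apply: (lt_le_trans (truncnS_gt _)).
have lim n : `‖x - u n.+1‖ <= 1 / 2 / 3 ^+ n.
  rewrite leNgt; apply/negP => lt.
  rewrite -subr_gt0 in lt; have [K hK] := hx _ lt.
  have := hK _ (leq_addl n.+1 K); have := tail' n.+1 K.
  have := hnorm_triangle (u (n.+1 + K)%N) x (u n.+1).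
  rewrite (hdistC x (u (n.+1 + K)%N)) exprS invfM.
  by move: (3 ^- n : R) => w; lra.
exists x => n z; have [N0 FN y1 Fy] := hNy n.
apply: (le_trans (FN z)); rewrite ler_wpM2r ?hnorm_ge0//.
have h1 : `‖F n (y n)‖ <= 3 ^+ n * `‖F n (u n.+1)‖ by have := hb (n, u n).
have h2 := FN (u n.+1 - x); rewrite hdistC in h2.
have h3 := ler_wpM2l N0 (lim n).
have h4 := hnormD (F n (u n.+1 - x)) (F n x); rewrite linearB subrK -linearB /= in h4.
have h5 : `‖F n (u n.+1)‖ <= N n * (1 / 2 / 3 ^+ n) + `‖F n x‖ by lra.
have h6 := ler_wpM2l (ltW (p3 n)) h5.
have h7 : 3 ^+ n * (N n * (1 / 2 / 3 ^+ n)) = N n / 2.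
  by field; rewrite gt_eqF.
by rewrite mulrDr h7 in h6; lra.
Qed.

End uniform_boundedness.

(** * The generator of a semigroup *)

Section semigroup.
Context {R : realType}.

(** Integrating from -1 makes the derivative at 0 two-sided. *)
Lemma continuous_primitive (f : R -> R) : continuous f ->
  exists G : R -> R, G 0 = 0 /\ forall s : R, -1 < s -> is_derive s 1 G (f s).
Proof.
move=> fc; pose F (x : R) := (\int[lebesgue_measure]_(t in `[-1, x]) f t)%R : R.
exists (fun x => F x - F 0); rewrite subrr; split=> // s s1.
have s2 : s < s + 1 by rewrite ltrDl.
have [|dF F's] := @continuous_FTC1_closed R f (-1) s _ s2 _ s1 (fc s).
  apply: continuous_compact_integrable; first exact: segment_compact.
  exact: continuous_subspaceT.
have dFs : is_derive s 1 F (f s).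
  by apply: (DeriveDef dF); rewrite -F's derive1E.
have := is_deriveB dFs (is_derive_cst (F 0) s 1).
by rewrite subr0.
Qed.

(** For c = e = 0 this is the uniqueness of primitives. *)
Lemma mean_value_bound (G g : R -> R) (a b c e : R) :
  (forall s : R, -1 < s -> is_derive s 1 G (g s)) -> -1 < a -> a <= b ->
  (forall s, a <= s <= b -> `|g s - c| <= e) ->
  `|G b - G a - c * (b - a)| <= e * (b - a).
Proof.
move=> dG a1 ab ge.
have [||s] := @MVT_segment R G g a b ab.
- by move=> s; rewrite in_itv /= => /andP[? _]; apply: dG; lra.
- apply: derivable_within_continuous => s; rewrite in_itv /= => /andP[? _].
  by have [] := dG s (lt_le_trans a1 _).
rewrite in_itv /= => /ge h ->; rewrite -mulrBl normrM (ger0_norm (_ : 0 <= b - a)).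
  by rewrite ler_wpM2r ?subr_ge0.
by rewrite subr_ge0.
Qed.

Context {k : scalar_kind} {H : hilbertType R k}.

(** The vector I t is the integral of [g] from 0 to t, obtained from its inner
    products G y t with the vectors y: these depend linearly on y by uniqueness
    of primitives, and continuously because [g] is bounded. *)
Lemma curve_primitive (g : R -> H) (M : R) :
  (forall y, continuous (fun s => Re⟨g s, y⟩)) -> (forall s, `‖g s‖ <= M) ->
  exists (G : H -> R -> R) (I : R -> H),
    [/\ forall y, G y 0 = 0,
        forall y (s : R), -1 < s -> is_derive s 1 (G y) Re⟨g s, y⟩ &
        forall y t, 0 <= t -> Re⟨I t, y⟩ = G y t].
Proof.
move=> gc gM.
have /choice[G hG] := fun y => continuous_primitive (gc y).
have G0 y : G y 0 = 0 by have [] := hG y.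
have dG y (s : R) : -1 < s -> is_derive s 1 (G y) Re⟨g s, y⟩ by have [_ h] := hG y; exact: h.
have m1 : -1 < 0 :> R by lra.
suff /choice[I hI] : forall t, exists q, 0 <= t -> forall y, Re⟨q, y⟩ = G y t.
  by exists G, I; split=> // y t t0; exact: hI.
move=> t; have [t0|t0] := leP 0 t; last by exists 0.
have [|||q hq] := @real_riesz R k H (G ^~ t) (t * M).
- move=> x y; have d (s : R) : -1 < s ->
      is_derive s 1 (G (x + y) - G x - G y) (Re⟨g s, x + y⟩ - Re⟨g s, x⟩ - Re⟨g s, y⟩).
    by move=> s1; apply: is_deriveB; [apply: is_deriveB|]; exact: dG.
  have := @mean_value_bound _ _ 0 t 0 0 d m1 t0.
  rewrite !mul0r !subr0 normr_le0 !fctE !G0 !subr0 => h.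
  apply/eqP; rewrite -subr_eq0 opprD addrA; apply: h => s _.
  by rewrite normr_le0 reDr; apply/eqP; ring.
- move=> a x; have d (s : R) : -1 < s ->
      is_derive s 1 (G (a *r x) - a \*: G x) (Re⟨g s, a *r x⟩ - a * Re⟨g s, x⟩).
    by move=> s1; apply: is_deriveB; [|apply: is_deriveZ]; exact: dG.
  have := @mean_value_bound _ _ 0 t 0 0 d m1 t0.
  rewrite -[(_ - _ \*: _) t]/(G (a *r x) t - a * G x t).
  rewrite -[(_ - _ \*: _) 0]/(G (a *r x) 0 - a * G x 0).
  rewrite !mul0r !subr0 normr_le0 !G0 mulr0 !subr0 => h.
  apply/eqP; rewrite -subr_eq0; apply: h => s _.
  by rewrite normr_le0 reZr; apply/eqP; ring.
- move=> x; have := @mean_value_bound _ _ 0 t 0 (M * `‖x‖) (dG x) m1 t0.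
  rewrite G0 mul0r !subr0 (mulrC t) mulrAC; apply => s _; rewrite subr0.
  by apply: (le_trans (re_abs_le _ _)); rewrite ler_wpM2r ?hnorm_ge0.
by exists q => _ y; rewrite hq.
Qed.

Lemma at_right0P (P : R -> Prop) :
  (\forall t \near 0^'+, P t) <-> exists2 d : R, 0 < d & forall t, 0 < t < d -> P t.
Proof.
split.
  move=> /nbhs_ballP[d /= d0 hd]; exists d => // t /andP[t0 td].
  by apply: hd => //=; rewrite /ball/= sub0r normrN gtr0_norm.
move=> [d d0 hd]; near=> t; apply: hd; apply/andP; split; near: t.
  exact: nbhs_right_gt.
exact: nbhs_right_lt.
Unshelve. all: end_near. Qed.

Variables (T : R -> {bounded H -> H}).
Hypothesis semiT : C0_semigroup T.

Lemma orbit_right_continuous x (e : R) : 0 < e ->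
  exists2 d : R, 0 < d & forall t, 0 <= t < d -> `‖T t x - x‖ < e.
Proof.
move=> e0; have /cvg_hnormP/(_ _ e0)/at_right0P[d d0 hd] :=
    @C0_semigroup_cvg _ _ _ _ semiT x.
exists d => // t; rewrite le_eqVlt => /andP[/predU1P[<-|t0] td].
  by rewrite (C0_semigroup0 semiT) subrr hnorm0.
by apply: hd; rewrite t0.
Qed.

(** Otherwise there are times tau n tending to 0 at which the norm of T grows
    so fast that the vector x of [gliding_hump] satisfies |T (tau n) x| > n,
    against the continuity of its orbit at 0. *)
Lemma semigroup_locally_bounded : exists (d M : R), [/\ 0 < d, 0 <= M &
  forall t x, 0 <= t <= d -> `‖T t x‖ <= M * `‖x‖].
Proof.
apply: contrapT => no.
have /choice[tau /all_and2[tau0 /choice[y hy]]] : forall n : nat, exists t : R,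
    0 <= t <= n.+1%:R^-1 /\ exists y, n%:R * (6 * 3 ^+ n) * `‖y‖ < `‖T t y‖.
  move=> n; apply: contrapT => no'; apply: no.
  exists n.+1%:R^-1, (n%:R * (6 * 3 ^+ n)); split.
  - by rewrite invr_gt0.
  - by rewrite !mulr_ge0// exprn_ge0.
  - move=> t x ht; rewrite leNgt; apply/negP => lt; apply: no'.
    by exists t; split=> //; exists x.
have [x hx] := gliding_hump (T \o tau).
have [d d0 hd] := orbit_right_continuous x ltr01.
pose n := maxn (Num.truncn d^-1) (Num.truncn (1 + `‖x‖)).+1.
have /hd : 0 <= tau n < d.
  have /andP[-> h] := tau0 n; rewrite /=; apply: (le_lt_trans h).
  rewrite invf_plt ?posrE// (lt_le_trans (truncnS_gt _))// ler_nat ltnS.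
  exact: leq_maxl.
have xn : 1 + `‖x‖ < n%:R.
  by apply: (lt_le_trans (truncnS_gt _)); rewrite ler_nat leq_maxr.
have := hnormD (T (tau n) x - x) x; rewrite subrK.
have := hx n (y n); have := hy n; rewrite /=; move: (T (tau n) (y n)) => z h1 h2 h3 h4.
have q0 : 0 <= 6 * 3 ^+ n :> R by rewrite mulr_ge0// exprn_ge0.
have : n%:R < `‖T (tau n) x‖.
  rewrite ltNge; apply/negP => h6; move: (lt_le_trans h1 h2).
  rewrite -!(mulrC `‖y n‖) ltr_pM2l; last first.
    rewrite lt_def hnorm_ge0 andbT; apply/eqP => y0.
    by move: (lt_le_trans h1 h2); rewrite y0 !mulr0 ltxx.
  rewrite (mulrC n%:R) ltr_pM2l ?mulr_gt0 ?exprn_gt0// => h7.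
  by have := lt_le_trans h7 h6; rewrite ltxx.
move: h3 h4 xn; move: `‖T (tau n) x‖ `‖x‖ `‖T (tau n) x - x‖ (n%:R : R) => a b c r.
by clear; lra.
Qed.

Variable A : partial_operator H H.
Hypothesis genA : is_generator T A.

Lemma op_dom_intro x w :
  (forall e : R, 0 < e -> exists2 d : R, 0 < d &
     forall h, 0 < h < d -> `‖T h x - x - h *r w‖ <= e * h) ->
  op_dom A x.
Proof.
move=> hw; have [-> _] := genA; rewrite /mkset; apply/cvg_ex; exists w.
apply/cvg_hnormP => e e0; have e2 : 0 < e / 2 by rewrite divr_gt0.
have [d d0 hd] := hw _ e2; apply/at_right0P; exists d => // h hh.
have /andP[h0 _] := hh.
have -> : h^-1 *r (T h x - x) - w = h^-1 *r (T h x - x - h *r w).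
  by apply: re_eqP => y; rewrite !reE; field; rewrite gt_eqF.
rewrite hnormZ ger0_norm ?invr_ge0 ?(ltW h0)// ltr_pdivrMl//.
by apply: (le_lt_trans (hd _ hh)); rewrite mulrC ltr_pM2l//; lra.
Qed.

(** For small t > 0 the integral I t of the orbit of y over [0, t] lies in the
    domain, since T h (I t) - I t is the integral over [t, t + h] minus that
    over [0, h], whose quotients by h tend to T t y - y.  But <I t, y> is close
    to t |y|^2, so that y cannot be orthogonal to the domain unless y = 0. *)
Lemma generator_dense y : (forall x, op_dom A x -> Re⟨x, y⟩ = 0) -> y = 0.
Proof.
have [d [M [d0 M0 TM]]] := semigroup_locally_bounded.
(* [clamp] extends the orbit on [0, d] to a bounded continuous curve on the
   whole line. *)
pose clamp (s : R) := Num.min (Num.max s 0) d.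
have clamp_itv s : 0 <= clamp s <= d.
  by rewrite /clamp le_min le_max lexx orbT (ltW d0) ge_min lexx orbT.
have clampE (s : R) : 0 <= s <= d -> clamp s = s.
  by move=> /andP[s0 sd]; rewrite /clamp (max_idPl s0) (min_idPl sd).
have clamp_le (s t : R) : `|clamp s - clamp t| <= `|s - t|.
  rewrite /clamp !minEle !maxEle !ler_norml.
  have := ler_norm (s - t); have := ler_norm (- (s - t)); rewrite normrN.
  move: `|s - t| => r; case: (leP s 0) => ?; case: (leP t 0) => ?;
    do 2 ?[case: (leP _ d) => ?]; lra.
have orbit_modulus z (s t : R) : 0 <= s <= d -> 0 <= t <= d ->
    `‖T s z - T t z‖ <= M * `‖T `|s - t| z - z‖.
  wlog ts : s t / t <= s => [wl|hs ht].
    have [ts|st] := leP t s; first exact: wl.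
    by rewrite hdistC distrC => ? ?; apply: wl => //; exact: ltW.
  have [t0 _] := andP ht; rewrite ger0_norm ?subr_ge0// -{1}(subrKC t s).
  rewrite [T (t + (s - t)) z](C0_semigroupD semiT) ?subr_ge0//.
  by rewrite -linearB /=; exact: TM.
pose g s := T (clamp s) y.
have gc z : continuous (fun s => Re⟨g s, z⟩).
  move=> s; apply/cvgrPdist_lt => e e0.
  have c0 : 0 < 1 + M * (1 + `‖z‖) by rewrite ltr_pwDl// mulr_ge0// addr_ge0 ?hnorm_ge0.
  have [r r0 hr] := orbit_right_continuous y (divr_gt0 e0 c0).
  apply/nbhs_ballP; exists r => //= t st.
  have := orbit_modulus y _ _ (clamp_itv s) (clamp_itv t).
  have /hr : 0 <= `|clamp s - clamp t| < r.
    by rewrite normr_ge0 (le_lt_trans (clamp_le _ _)).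
  rewrite -reNl -reDl /g; move: (T _ y - T _ y) (T _ y - y) => u v.
  rewrite ltr_pdivlMr// => h1 h2; apply: (le_lt_trans (re_abs_le _ _)).
  apply: le_lt_trans h1; have := ler_wpM2r (hnorm_ge0 z) h2.
  have := hnorm_ge0 z; have := hnorm_ge0 v; nra.
have [|G [I [G0 dG GI]]] := @curve_primitive g (M * `‖y‖) gc.
  by move=> s; exact: TM.
have near_orbit t e : 0 <= t <= d -> 0 < e -> exists2 r : R, 0 < r &
    forall a s z, 0 <= a -> t - r < a -> a <= s -> s < t + r -> s <= d ->
      `|G z s - G z a - Re⟨T t y, z⟩ * (s - a)| <= e * `‖z‖ * (s - a).
  move=> td e0; have c0 : 0 < 1 + M by rewrite ltr_pwDl.
  have [r r0 hr] := orbit_right_continuous y (divr_gt0 e0 c0).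
  exists r => // a s z a0 ta as_ st sd.
  apply: (mean_value_bound (dG z)) => //; first lra.
  move=> u /andP[au us]; have ud : 0 <= u <= d by rewrite (le_trans a0)//= (le_trans us).
  rewrite -reNl -reDl; apply: (le_trans (re_abs_le _ _)).
  rewrite ler_wpM2r ?hnorm_ge0// /g clampE//.
  apply: (le_trans (orbit_modulus y u t ud td)).
  have /hr : 0 <= `|u - t| < r by rewrite normr_ge0 ltr_norml; lra.
  by rewrite ltr_pdivlMr//; move: (hnorm_ge0 (T `|u - t| y - y)); nra.
have I_dom t : 0 < t < d -> op_dom A (I t).
  move=> /andP[t0 td]; apply: (@op_dom_intro _ (T t y - y)) => e e0.
  have e2 : 0 < e / 2 by lra.
  have [|r1 r10 h1] := @near_orbit t _ _ e2; first lra.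
  have [|r2 r20 h2] := @near_orbit 0 _ _ e2; first lra.
  exists (Num.min (d - t) (Num.min r1 r2)) => [|h].
    by rewrite !lt_min subr_gt0 td r10.
  rewrite !lt_min => /and4P[hh0 hdt hr1 hr2].
  have thd : t + h <= d by rewrite addrC -lerBrDr ltW.
  have hd : h <= d by apply: le_trans thd; rewrite lerDr ltW.
  apply: hnorm_duality => [|z]; first by rewrite mulr_ge0// ltW.
  have -> : Re⟨T h (I t) - I t - h *r (T t y - y), z⟩ =
      (G z (t + h) - G z t - Re⟨T t y, z⟩ * (t + h - t)) -
      (G z h - G z 0 - Re⟨T 0 y, z⟩ * (h - 0)).
    rewrite (C0_semigroup0 semiT) G0 !reE bounded_adjointP !GI ?(ltW t0)//.
    set z' := bounded_adjoint _ z.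
    (* moving [T h] to the other side makes both functions primitives of
       Re <T (s + h) y, z> *)
    have shift_deriv (s : R) : -1 < s -> is_derive s 1 (G z \o shift h - G z')
        (Re⟨g (s + h), z⟩ * 1 - Re⟨g s, z'⟩).
      move=> s1; apply: is_deriveB; last exact: dG.
      apply: is_derive1_comp; last exact: is_derive_shift.
      by apply: dG => /=; lra.
    have := @mean_value_bound _ _ 0 t 0 0 shift_deriv.
    rewrite -[(_ - _) t]/(G z (t + h) - G z' t) -[(_ - _) 0]/(G z (0 + h) - G z' 0).
    rewrite G0 add0r !mul0r !subr0 normr_le0 => hs.
    have : G z (t + h) - G z' t - G z h == 0.
      apply: hs; [lra|exact: ltW|] => s /andP[s0 st].
      have sd : s <= d by rewrite (le_trans st)// ltW.
      have shd : s + h <= d by apply: le_trans thd; rewrite lerD2r.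
      rewrite mulr1 subr0 /g !clampE ?s0 ?sd ?shd ?addr_ge0 ?(ltW hh0)//.
      by rewrite (addrC s) (C0_semigroupD semiT)// ?(ltW hh0)// bounded_adjointP subrr normr0.
    by move: (G z (t + h)) (G z' t) (G z h) => a b c /eqP; clear; lra.
  apply: (le_trans (ler_norm _)); apply: (le_trans (ler_normB _ _)).
  have := h1 t (t + h) z; have := h2 0 h z; rewrite subr0 => p2 p1.
  rewrite lexx ltrBlDr add0r in p2; rewrite ltrBlDr ltrDl lerDl ltrD2l in p1.
  have p1' := p1 (ltW t0) r10 (ltW hh0) hr1 thd.
  have p2' := p2 isT r20 (ltW hh0) hr2 hd.
  apply: (le_trans (lerD p1' p2')).
  by rewrite (addrC t) addrK -mulrDl -mulrDl -splitr mulrAC.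
move=> orth; apply: hnorm0_eq0; apply: contrapT => /eqP y0.
have yp : 0 < `‖y‖ by rewrite lt_def y0 hnorm_ge0.
have y2 : 0 < `‖y‖ / 2 by rewrite divr_gt0.
have [|r r0 hr] := @near_orbit 0 _ _ y2; first lra.
pose t := Num.min r d / 2.
have rd : 0 < Num.min r d by rewrite lt_min r0.
have /andP[tr td] : (t < r) && (t < d).
  have := ge_min r d; rewrite /t.
  have : Num.min r d <= r by rewrite ge_min lexx.
  have : Num.min r d <= d by rewrite ge_min lexx orbT.
  by move: (Num.min r d) rd => m; lra.
have t0 : 0 < t by rewrite divr_gt0.
have := orth (I t) (I_dom t _); rewrite t0 td => /(_ isT).
rewrite (GI _ _ (ltW t0)) => Gt0.
have := hr 0 t y (lexx 0); rewrite Gt0 G0 (C0_semigroup0 semiT) -hnorm_sqr subr0.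
rewrite ltrBlDr !add0r r0 !subr0 => /(_ isT (ltW t0) tr (ltW td)).
rewrite normrN ger0_norm; last by apply: mulr_ge0; [exact: sqr_ge0|exact: ltW].
by rewrite ler_pM2r// expr2 ler_pM2r// leNgt ltr_pdivrMr// ltr_pMr// ltrDl ltr01.
Qed.

Lemma generator_linear c x y : op_dom A x -> op_dom A y ->
  op_dom A (c *: x + y) /\ A (c *: x + y) = c *: A x + A y.
Proof.
have [domE Acvg] := genA => Ax Ay.
have e (t : R) : t^-1 *r (T t (c *: x + y) - (c *: x + y)) =
    c *: (t^-1 *r (T t x - x)) + t^-1 *r (T t y - y).
  rewrite linearP opprD addrACA -scalerBr scalerDr.
  by rewrite !scalerA (mulrC c).
have cv : t^-1 *r (T t (c *: x + y) - (c *: x + y)) @[t --> 0^'+] -->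
    c *: A x + A y.
  rewrite (_ : (fun t => _) = (fun t => c *: (t^-1 *r (T t x - x)) + t^-1 *r (T t y - y))).
    by apply: cvgD; [apply: cvgZr|]; exact: Acvg.
  by apply/funext.
have dom : op_dom A (c *: x + y) by rewrite domE; apply/cvg_ex; eexists; exact: cv.
split=> //; apply: (cvg_unique (@norm_hausdorff _ H) (Acvg _ dom) cv).
Qed.

End semigroup.

(** * Quadratic storage functions *)

Section quadratic_storage.
Context {R : realType} {k : scalar_kind} {H : hilbertType R k}.

Lemma quadratic_expand (P : {bounded H -> H}) (w x h : H) : self_adjoint P ->
  quadratic P w (x + h) = quadratic P w x + 2 * Re⟨P x + w, h⟩ + Re⟨P h, h⟩.
Proof.
move=> /self_adjointP Ps; rewrite /quadratic boundedD !reE (Ps h x) (reC h); ring.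
Qed.

Lemma quadratic_C1 (P : {bounded H -> H}) (w : H) : self_adjoint P ->
  is_C1_with_derivative (quadratic P w) (fun x h => 2 * Re⟨P x + w, h⟩).
Proof.
move=> Ps; have [M M0 PM] := bounded_operator_le P.
split=> [x|x e e0].
  split=> [h1 h2|a h|h|].
  - by rewrite reDr mulrDr.
  - by rewrite reZr mulrCA.
  - apply/cvgrPdist_lt => e e0; apply/near_hnormP.
    have c0 : 0 < 1 + 2 * `‖P x + w‖ by rewrite ltr_pwDl// mulr_ge0// hnorm_ge0.
    exists (e / (1 + 2 * `‖P x + w‖)) => [|y]; first by rewrite divr_gt0.
    rewrite ltr_pdivlMr// => h1.
    rewrite -mulrBr -reNr -reDr normrM ger0_norm// hdistC in h1 *.
    have := re_abs_le (P x + w) (h - y); have := hnorm_ge0 (h - y); nra.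
  - apply/cvgrPdist_lt => e e0; rewrite near_withinE; apply/near_hnormP.
    exists (e / M) => [|h]; first by rewrite divr_gt0.
    rewrite subr0 ltr_pdivlMr// => h1 /hnorm_gt0 hp.
    rewrite (quadratic_expand _ _ _ Ps) sub0r normrN.
    have -> : quadratic P w x + 2 * Re⟨P x + w, h⟩ + Re⟨P h, h⟩ - quadratic P w x
        - 2 * Re⟨P x + w, h⟩ = Re⟨P h, h⟩ by ring.
    rewrite normrM (ger0_norm (_ : 0 <= `‖h‖^-1)) ?invr_ge0 ?hnorm_ge0//.
    rewrite ltr_pdivrMr//; apply: (le_lt_trans (re_abs_le _ _)).
    by rewrite ltr_pM2r//; apply: (le_lt_trans (PM h)); rewrite mulrC.
apply/near_hnormP; exists (e / (2 * M)) => [|y]; first by rewrite divr_gt0// mulr_gt0.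
rewrite ltr_pdivlMr ?mulr_gt0// => h1 h.
have -> : 2 * Re⟨P y + w, h⟩ - 2 * Re⟨P x + w, h⟩ = 2 * Re⟨P (y - x), h⟩.
  by rewrite boundedB !reE; ring.
rewrite normrM ger0_norm//; have := re_abs_le (P (y - x)) h.
have := ler_wpM2r (hnorm_ge0 h) (PM (y - x)); have := hnorm_ge0 h; nra.
Qed.

(** Two derivatives differ by a homogeneous function that is o(|h|).  This makes
    the derivative in a dissipation inequality the explicit one. *)
Lemma real_derivative_unique (V : H -> R) x (d1 d2 : H -> R) :
  is_real_derivative V x d1 -> is_real_derivative V x d2 -> d1 =1 d2.
Proof.
move=> [D1 Z1 _ c1] [D2 Z2 _ c2] h.
have [->|h0] := eqVneq h 0.
  have d0 (d : H -> R) : (forall a b, d (a + b) = d a + d b) -> d 0 = 0.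
    by move=> dD; apply: (addrI (d 0)); rewrite -dD !addr0.
  by rewrite !d0.
have hp := hnorm_gt0 h0.
apply/eqP; rewrite -subr_eq0 -normr_le0 leNgt; apply/negP.
set D := `|d1 h - d2 h| => D0.
have e0 : 0 < D / 2 / `‖h‖ by rewrite !divr_gt0.
have /cvgrPdist_lt/(_ _ e0) n1 := c1; have /cvgrPdist_lt/(_ _ e0) n2 := c2.
have /near_hnormP[r r0 hr] : \forall y \near (0 : H), y != 0 ->
    `|0 - (V (x + y) - V x - d1 y) / `‖y‖| < D / 2 / `‖h‖ /\
    `|0 - (V (x + y) - V x - d2 y) / `‖y‖| < D / 2 / `‖h‖.
  exact: filterI n1 n2.
pose s := r / 2 / `‖h‖; have s0 : 0 < s by rewrite !divr_gt0.
have sh : `‖s *r h‖ = s * `‖h‖ by rewrite hnormZ gtr0_norm.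
have small : `‖s *r h - 0‖ < r.
  by rewrite subr0 sh /s divfK ?gt_eqF// ltr_pdivrMr// ltr_pMr// ltrDl ltr01.
have sh0 : s *r h != 0.
  by apply: contraTneq (mulr_gt0 s0 hp) => e; rewrite -sh e hnorm0 ltxx.
have [] := hr _ small sh0; rewrite !sub0r !normrN sh Z1 Z2.
move: (V _ - V x) => W; rewrite !normrM normfV (gtr0_norm (mulr_gt0 s0 hp)).
have eD : D / 2 / `‖h‖ * (s * `‖h‖) = D / 2 * s by field; rewrite gt_eqF.
rewrite !(ltr_pdivrMr _ _ (mulr_gt0 s0 hp)) eD => h1 h2.
have := ler_distD W (s * d1 h) (s * d2 h).
rewrite -mulrBr normrM (gtr0_norm s0) -/D (distrC _ W) => h3.
have := lt_le_trans (ltrD h1 h2) (_ : _ <= s * D); rewrite -mulrDl -splitr mulrC lexx.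
by move=> /(_ isT)/(le_lt_trans h3); rewrite ltxx.
Qed.

End quadratic_storage.

(** * Strict dissipativity *)

Section dissipation.
Context {R : realType} {k : scalar_kind} {H U Y Z : hilbertType R k}.
Variables (A : partial_operator H H) (B : {bounded U -> H}).
Variables (C : {bounded H -> Y}) (K : {bounded U -> Z}) (z : H) (v : U).
Hypothesis A_linear : forall c x y, op_dom A x -> op_dom A y ->
  op_dom A (c *: x + y) /\ A (c *: x + y) = c *: A x + A y.
Hypothesis A_dense : forall y, (forall x, op_dom A x -> Re⟨x, y⟩ = 0) -> y = 0.

Lemma op_domZ c x : op_dom A x -> op_dom A (c *: x) /\ A (c *: x) = c *: A x.
Proof.
move=> Ax; have [h e] := A_linear (-1) Ax Ax.
have A0 : A 0 = 0 by move: e; rewrite !scaleN1r !addNr.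
rewrite scaleN1r addNr in h.
by have := A_linear c Ax h; rewrite !addr0 A0 addr0.
Qed.

(** The value of the adjoint is chosen among all candidates; density of the
    domain leaves only one. *)
Lemma adjointP w y :
  (forall x, op_dom A x -> Re⟨A x, w⟩ = Re⟨x, y⟩) <->
  (op_dom (adjoint A) w /\ adjoint A w = y).
Proof.
split=> [h|[dw <-] x Ax]; last first.
  by case: dw => q hq; have := xgetI 0 hq => ->.
have hy : adjoint_value A w y.
  by apply: inner_eq_re => // c x Ax; have [] := op_domZ c Ax.
split; first by exists y.
have hx := xgetI 0 hy; apply/subr0_eq; apply: A_dense => x Ax.
by rewrite reDr reNr -hx// -hy// subrr.
Qed.

Variables (xe : H) (ue : U).
Hypothesis he : controlled_equilibrium A B xe ue.

(** The first-order terms of the cost at the equilibrium are the right-hand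
    sides of the two adjoint equations. *)
Lemma running_cost_expand x u :
  running_cost C K z v (xe + x) (ue + u) - running_cost C K z v xe ue =
  `‖C x‖ ^+ 2 + `‖K u‖ ^+ 2 + 2 * Re⟨x, z + bounded_adjoint C (C xe)⟩
    + 2 * Re⟨u, v + bounded_adjoint K (K ue)⟩.
Proof.
rewrite /running_cost !reDr -!bounded_adjointP !boundedD !hnorm_sqr !reE.
rewrite !(reC z) !(reC v) (reC (C xe) (C x)) (reC (K ue) (K u)); ring.
Qed.

Lemma equilibrium_shift x u : op_dom A x ->
  op_dom A (xe + x) /\ A (xe + x) + B (ue + u) = A x + B u.
Proof.
have [Axe e0] := he => Ax; have [] := A_linear 1 Axe Ax.
rewrite !scale1r => ? ->; split=> //.
by rewrite boundedD addrACA e0 add0r.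
Qed.

(** The operator of the storage function itself serves as [P], with
    [m = alpha 1]. *)
Lemma dissipative_necessary (P : {bounded H -> H}) (w : H) :
  self_adjoint P -> strictly_dissipative A B (running_cost C K z v) xe ue (quadratic P w) ->
  exists m : R,
     [/\ nonnegative P, 0 < m,
         [set w | [/\ op_dom (adjoint A) w,
                      adjoint A w = z + bounded_adjoint C (C xe) &
                      bounded_adjoint B w = v + bounded_adjoint K (K ue)]]
           `&` range (nonneg_sqrt P) !=set0 &
         forall x, op_dom A x ->
           m * `‖x‖ ^+ 2 <= `‖C x‖ ^+ 2 - 2 * Re⟨A x, P x⟩].
Proof.
move=> Ps [[dV [[dV1 _] [alpha [[_ alpha_mono alpha0] diss]]]] [b lb]].
have alpha_gt0 r : 0 < r -> 0 < alpha r.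
  by move=> r0; rewrite -alpha0; apply: alpha_mono; rewrite ?in_itv/= ?lexx ?(ltW r0).
have alpha_ge0 r : 0 <= r -> 0 <= alpha r.
  by rewrite le_eqVlt => /predU1P[<-|/alpha_gt0/ltW//]; rewrite alpha0.
have dVE x h : dV x h = 2 * Re⟨P x + w, h⟩.
  have [dq _] := quadratic_C1 w Ps.
  exact: (real_derivative_unique (dV1 x) (dq x)).
pose wt := P xe + w.
have ineq x u : op_dom A x ->
    2 * Re⟨A x + B u, P x⟩ + 2 * Re⟨A x + B u, wt⟩ <=
    `‖C x‖ ^+ 2 + `‖K u‖ ^+ 2 + 2 * Re⟨x, z + bounded_adjoint C (C xe)⟩
    + 2 * Re⟨u, v + bounded_adjoint K (K ue)⟩ - alpha `‖x‖.
  move=> Ax; have [Axs e] := equilibrium_shift u Ax.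
  have := diss (xe + x) (ue + u) Axs.
  rewrite running_cost_expand e dVE [in `‖_ - _‖]addrC addKr; apply: le_trans.
  rewrite le_eqVlt; apply/orP; left; apply/eqP.
  by rewrite boundedD /wt (reC (_ + w)) !reDr; ring.
have first_order x u : op_dom A x -> Re⟨A x + B u, wt⟩ =
    Re⟨x, z + bounded_adjoint C (C xe)⟩ + Re⟨u, v + bounded_adjoint K (K ue)⟩.
  move=> Ax; apply/eqP; rewrite eq_sym -subr_eq0; apply/eqP.
  set L := _ - _; suff : 2 * L = 0 by move=> /eqP; rewrite mulf_eq0 pnatr_eq0 => /eqP.
  apply: (@quadratic_ge0_linear0 R (`‖C x‖ ^+ 2 + `‖K u‖ ^+ 2 - 2 * Re⟨A x + B u, P x⟩)) => t.
  have [Atx Atxe] := op_domZ (scalar_of_real k t) Ax.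
  have := ineq _ (t *r u) Atx; have := alpha_ge0 _ (hnorm_ge0 (t *r x)).
  rewrite /L Atxe !boundedZ !hnorm_sqr !reE; lra.
have wtA x : op_dom A x -> Re⟨A x, wt⟩ = Re⟨x, z + bounded_adjoint C (C xe)⟩.
  by move=> Ax; have := first_order x 0 Ax; rewrite bounded0 re0l !addr0.
have A00 : op_dom A 0 /\ A 0 = 0.
  by have [Axe _] := he; have [] := op_domZ 0 Axe; rewrite !scale0r.
have wtB u : Re⟨B u, wt⟩ = Re⟨u, v + bounded_adjoint K (K ue)⟩.
  by have := first_order 0 u A00.1; rewrite A00.2 re0l !add0r.
have lbV x : b <= Re⟨P x, x⟩ + 2 * Re⟨w, x⟩ by apply: lb; exists x.
have P0 : nonnegative P.
  apply/(nonnegativeP Ps) => x; rewrite leNgt; apply/negP => neg.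
  (* along multiples of [x] the storage function is a downward parabola; [t]
     is far enough out to fall below [b] *)
  pose q := - Re⟨P x, x⟩; have q0 : 0 < q by rewrite oppr_gt0.
  pose t := (1 + `|b| + 2 * `|Re⟨w, x⟩|) / q + 1.
  have n0 : 0 < 1 + `|b| + 2 * `|Re⟨w, x⟩| by rewrite -addrA ltr_pwDl// addr_ge0// mulr_ge0.
  have t1 : 1 <= t by rewrite lerDr divr_ge0// ltW.
  have tq : q * t = 1 + `|b| + 2 * `|Re⟨w, x⟩| + q by rewrite /t; field; rewrite gt_eqF.
  have := lbV (t *r x); rewrite boundedZ !reE.
  have : t * Re⟨w, x⟩ <= t * `|Re⟨w, x⟩| by rewrite ler_wpM2l ?ler_norm//; lra.
  have : - b <= `|b| by rewrite -normrN ler_norm.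
  have : t * (q * t) = t * (1 + `|b| + 2 * `|Re⟨w, x⟩| + q) by rewrite tq.
  have := mulr_ge0 (_ : 0 <= t - 1) (normr_ge0 b).
  rewrite subr_ge0 => /(_ t1).
  have := mulr_gt0 (lt_le_trans ltr01 t1) q0; rewrite /q; lra.
have [S [SE Ss SS]] := nonneg_sqrtP Ps P0.
(* |S x|^2 + 2 Re <w, x> is the storage function, hence bounded below *)
have [|||||q hq] := @minimizer_representation R k H H S (fun x => Re⟨w, x⟩) b.
- by move=> x y; rewrite boundedD.
- by move=> a x; rewrite boundedZ.
- by move=> x y; rewrite reDr.
- by move=> a x; rewrite reZr.
- move=> x; have /self_adjointP Ssym := Ss.
  by rewrite hnorm_sqr -Ssym SS; exact: lbV.
exists (alpha 1); split=> //; first exact: alpha_gt0.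
  exists wt; split.
    have [|dw ew] := (adjointP wt (z + bounded_adjoint C (C xe))).1; first exact: wtA.
    by split=> //; exact: bounded_adjoint_eq.
  rewrite SE; exists (S xe + q) => //; rewrite boundedD SS; congr (_ + _).
  apply: re_eqP => h; have /self_adjointP Ssym := Ss.
  by rewrite -Ssym reC -hq reC.
(* scale [x] to norm 1; the linear parts cancel by [first_order] *)
move=> x Ax; have [->|x0] := eqVneq x 0.
  by rewrite A00.2 re0l hnorm0 expr0n !mulr0 subr0 sqr_ge0.
have xp := hnorm_gt0 x0.
have [Atx Atxe] := op_domZ (scalar_of_real k `‖x‖^-1) Ax.
have := ineq _ 0 Atx; have := first_order _ 0 Atx => ->.
rewrite Atxe !bounded0 addr0 hnormZ ger0_norm ?invr_ge0 ?hnorm_ge0// mulVf ?gt_eqF//.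
rewrite !boundedZ hnormZ hnorm0 !reE ger0_norm ?invr_ge0 ?hnorm_ge0// => h.
have x2 : 0 < `‖x‖ ^+ 2 by rewrite exprn_gt0.
rewrite -ler_pdivlMr//.
have -> : (`‖C x‖ ^+ 2 - 2 * Re⟨A x, P x⟩) / `‖x‖ ^+ 2 =
  (`‖x‖^-1 * `‖C x‖) ^+ 2 - 2 * (`‖x‖^-1 * (`‖x‖^-1 * Re⟨A x, P x⟩)).
  by field; rewrite gt_eqF.
lra.
Qed.

(** The storage operator is c P.  The number c must be at most 1, so that the
    coercivity estimate times c still spends no more than |C h|^2, and at most
    m cK^2 / (2 M^2) with M a bound of P, so that Young's inequality absorbs
    the cross term 2 c Re <P h, B mu> into c m |h|^2 / 2 and |K mu|^2. *)
Lemma dissipative_sufficient (P : {bounded H -> H}) (m cK : R) :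
  self_adjoint P -> nonnegative P -> 0 < m -> 0 < cK ->
  (forall u, cK * `‖B u‖ <= `‖K u‖) ->
  [set w | [/\ op_dom (adjoint A) w,
               adjoint A w = z + bounded_adjoint C (C xe) &
               bounded_adjoint B w = v + bounded_adjoint K (K ue)]]
    `&` range (nonneg_sqrt P) !=set0 ->
  (forall x, op_dom A x -> m * `‖x‖ ^+ 2 <= `‖C x‖ ^+ 2 - 2 * Re⟨A x, P x⟩) ->
  exists (Q : {bounded H -> H}) (w : H), self_adjoint Q /\
     strictly_dissipative A B (running_cost C K z v) xe ue (quadratic Q w).
Proof.
move=> Ps P0 m0 cK0 hK [wt [[dw ew Bw] [q _ qE]]] coer.
have [S [SE Ss SS]] := nonneg_sqrtP Ps P0.
have /self_adjointP Ssym := Ss; have /self_adjointP Psym := Ps.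
have [M M0 PM] := bounded_operator_le P.
have wtA := (adjointP wt _).2 (conj dw ew).
have wtB u : Re⟨B u, wt⟩ = Re⟨u, v + bounded_adjoint K (K ue)⟩.
  by rewrite bounded_adjointP Bw.
(* d / (d + 2 M^2) is below both 1 and d / (2 M^2) *)
pose d := m * cK ^+ 2; have d0 : 0 < d by rewrite mulr_gt0// exprn_gt0.
have M2 : 0 <= 2 * M ^+ 2 by rewrite mulr_ge0 ?sqr_ge0.
have D0 : 0 < d + 2 * M ^+ 2 by rewrite ltr_pwDl.
pose c := d / (d + 2 * M ^+ 2); have c0 : 0 < c by rewrite divr_gt0.
have c1 : c <= 1 by rewrite ler_pdivrMr// mul1r lerDl.
have c2 : c * (2 * M ^+ 2) <= d.
  by rewrite mulrAC ler_pdivrMr// ler_pM2l// lerDr ltW.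
have slin : linear (fun x => c *r P x).
  by move=> a x y; rewrite boundedD boundedZ scalerDr !scalerA (mulrC a).
have cP_le x : `‖c *r P x‖ <= c * M * `‖x‖.
  by rewrite hnormZ gtr0_norm// -mulrA ler_pM2l.
have [Q QE] := bounded_operator_build slin cP_le.
have Qs : self_adjoint Q.
  by apply/self_adjointP => x y; rewrite QE !reE Psym.
exists Q, (wt - Q xe); split=> //; split; last first.
  exists (- (`‖q - c *r S xe‖ ^+ 2 / c)) => _ [x _ <-].
  have -> : quadratic Q (wt - Q xe) x = c * `‖S x‖ ^+ 2 + 2 * Re⟨q - c *r S xe, S x⟩.
    rewrite /quadratic QE -qE SE -!SS hnorm_sqr !reE (Ssym (S x)) (Ssym (S xe)) (Ssym q).
    by ring.
  (* expand |p + c S x|^2 >= 0 *)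
  move: (q - c *r S xe) => p; have := re_ge0 (p + c *r S x).
  rewrite !reE (reC (S x) p) -!hnorm_sqr lerNl ler_pdivlMr//.
  by lra.
have [dC1 dC2] := quadratic_C1 (wt - Q xe) Qs.
exists (fun x h => 2 * Re⟨Q x + (wt - Q xe), h⟩); split=> //.
exists (fun r => c * m / 2 * r ^+ 2); split.
  split.
  - apply: continuous_subspaceT => r; apply: cvgM; first exact: cvg_cst.
    exact: (@cvgM _ _ _ _ id id).
  - move=> r s; rewrite !in_itv /= !andbT => r0 s0 rs.
    have cm0 : 0 < c * m / 2 by rewrite divr_gt0// mulr_gt0.
    by rewrite (ltr_pM2l cm0) ltr_pXn2r.
  - by rewrite expr0n mulr0.
move=> x u; have [h ->] : exists h, x = xe + h by exists (x - xe); rewrite addrC subrK.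
have [mu ->] : exists mu, u = ue + mu by exists (u - ue); rewrite addrC subrK.
move=> Ax; have [Axe _] := he.
have Ah : op_dom A h.
  by have [] := A_linear (-1) Axe Ax; rewrite scaleN1r addKr.
have [_ ->] := equilibrium_shift mu Ah.
rewrite running_cost_expand (addrC xe h) addrK (addrC h xe) /=.
have -> : Q (xe + h) + (wt - Q xe) = Q h + wt.
  by rewrite boundedD; apply: re_eqP => y; rewrite !reE; ring.
rewrite -wtB -wtA// QE !reDr !(reDl (_ *: _)) !reZl !(reC wt) (reC (P h) (A h)).
have h1 := ler_wpM2l (ltW c0) (coer _ Ah).
have h2 : Re⟨P h, B mu⟩ <= M * `‖h‖ * `‖B mu‖.
  by apply: (le_trans (re_le _ _)); rewrite ler_wpM2r ?hnorm_ge0.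
have h3 : cK ^+ 2 * `‖B mu‖ ^+ 2 <= `‖K mu‖ ^+ 2.
  by rewrite -exprMn ler_pXn2r ?nnegrE ?mulr_ge0 ?hnorm_ge0// ltW.
have h4 : c * `‖C h‖ ^+ 2 <= `‖C h‖ ^+ 2 by rewrite ler_piMl// sqr_ge0.
have h5 : 2 * c * Re⟨P h, B mu⟩ <= c * m / 2 * `‖h‖ ^+ 2 + `‖K mu‖ ^+ 2.
  rewrite -(ler_pM2l m0).
  have f1 := ler_wpM2l (ltW (mulr_gt0 c0 m0)) h2.
  (* Young: the square of m |h| - 2 M |B mu| *)
  have f2 := mulr_ge0 (ltW c0) (sqr_ge0 (m * `‖h‖ - 2 * M * `‖B mu‖)).
  have f3 := ler_wpM2r (sqr_ge0 `‖B mu‖) c2; rewrite /d in f3.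
  have f4 := ler_wpM2l (ltW m0) h3.
  move: f1 f2 f3 f4; lra.
lra.
Qed.

End dissipation.

Theorem corollary14 (R : realType) (k : scalar_kind)
    (H U Y Z : hilbertType R k)
    (A : partial_operator H H) (B : {bounded U -> H})
    (C : {bounded H -> Y}) (K : {bounded U -> Z}) (z : H) (v : U)
    (hA : generates_C0_semigroup A)
    (hK : exists cK : R, 0 < cK /\ forall u : U, cK * `‖B u‖ <= `‖K u‖)
    (xe : H) (ue : U) (he : controlled_equilibrium A B xe ue) :
  (exists (P : {bounded H -> H}) (w : H), self_adjoint P /\
     strictly_dissipative A B (running_cost C K z v) xe ue (quadratic P w))
  <->
  (exists (P : {bounded H -> H}) (m : R),
     [/\ self_adjoint P, nonnegative P, 0 < m,
         [set w | [/\ op_dom (adjoint A) w,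
                      adjoint A w = z + bounded_adjoint C (C xe) &
                      bounded_adjoint B w = v + bounded_adjoint K (K ue)]]
           `&` range (nonneg_sqrt P) !=set0 &
         forall x, op_dom A x ->
           m * `‖x‖ ^+ 2 <= `‖C x‖ ^+ 2 - 2 * Re⟨A x, P x⟩]).
Proof.
have [T [semiT genA]] := hA; have [cK [cK0 KB]] := hK.
have lin := generator_linear genA; have dense := generator_dense semiT genA.
split=> [[P [w [Ps diss]]]|[P [m [Ps P0 m0 ran coer]]]].
  have [m [P0 m0 ran coer]] := dissipative_necessary lin dense he Ps diss.
  by exists P, m.
exact: (dissipative_sufficient lin dense he Ps P0 m0 cK0 KB ran coer).
Qed.
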